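(* Let $k=\mathbb{C}$, let $A=k[\Gamma]$ be a monomial curve, and let $D=\mathrm{Diff}(A)$ be its ring of $k$-linear differential operators. Let $M$ be a finitely generated left $D$-module. Then the following conditions are equivalent: (1) $M$ is holonomic; (2) $M$ has finite length; (3) $M$ is cyclic and not isomorphic to $D$.
   Context: Let $k=\mathbb{C}$ and $\mathbb{N}_0=\{0,1,2,\dots\}$. A numerical semigroup is a submonoid $\Gamma\subseteq\mathbb{N}_0$ with $\mathbb{N}_0\setminus\Gamma$ finite; its semigroup algebra $A=k[\Gamma]=\bigoplus_{n\in\Gamma}k\,t^n\subseteq k[t]$ is called a monomial curve. Put $T=k[t,t^{-1}]$ and $\partial=d/dt$. The ring $\mathrm{Diff}(T)=k[t,t^{-1}]\langle\partial\rangle$ is graded by letting $t^n\partial^m$ have degree $n-m$. The ring $D=\mathrm{Diff}(A)$ of $k$-linear differential operators on $A$ is identified with the graded subring $\{P\in\mathrm{Diff}(T):P(A)\subseteq A\}$, and we write $D=\bigoplus_w D_w$. Bernstein filtration: let $D^p_w$ be the space of operators in $D_w$ of order at most $p$, and let $B^n=\sum_{2p+w\le n}D^p_w$ for each integer $n$. Its associated graded ring is the commutative ring $\mathrm{gr}\,D=\bigoplus_n B^n/B^{n-1}$. A filtration of a left $D$-module $M$ is a chain $M_0\subseteq M_1\subseteq\cdots$ of $k$-linear subspaces of $M$ such that $\bigcup_n M_n=M$ and $B^m\cdot M_n\subseteq M_{m+n}$ for all $m,n\ge 0$, with $M_n=0$ for $n<0$. It is good if $\mathrm{gr}\,M=\bigoplus_n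 M_n/M_{n-1}$ is finitely generated over $\mathrm{gr}\,D$; a good filtration exists if and only if $M$ is finitely generated. Dimension: for a finitely generated $M\ne 0$ with good filtration $\{M_n\}$, there are $m\ge 1$ and polynomials $P_0,\dots,P_{m-1}\in\mathbb{Q}[t]$ with $\dim_k M_{nm+r}=P_r(n)$ for all large $n$ and $0\le r<m$, all of the form $P_r(t)=\frac{e}{d!}t^d+\text{(lower degree terms)}$ with $e>0$ a common positive integer and $d$ the Krull dimension of $\mathrm{gr}\,M$. The dimension of $M$ is $d(M)=d$; it is independent of the good filtration. A finitely generated left $D$-module $M$ is holonomic if $M\neq 0$ and $d(M)=1$; by convention $M=0$ is also holonomic. *)

(* Defs.v *)
From HB Require Import structures.
From mathcomp Require Import all_boot all_order all_algebra.
From mathcomp Require Import complex.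
From mathcomp Require Import mathcomp_extra boolp classical_sets functions.
From mathcomp Require Import cardinality fsbigop reals.
Set Implicit Arguments.
Unset Strict Implicit.
Unset Printing Implicit Defensive.
Import Order.TTheory GRing.Theory Num.Theory.
Local Open Scope classical_set_scope.
Local Open Scope ring_scope.

Definition numerical_semigroup (G : set nat) : Prop :=
  [/\ G 0%N, (forall m n, G m -> G n -> G (m + n)%N) & finite_set (~` G)].

Section Span.
Variables (K : fieldType) (V : lmodType K).

Definition subspace (U : set V) : Prop :=
  U 0 /\ forall (c : K) x y, U x -> U y -> U (c *: x + y).

Definition span (S : set V) : set V :=
  [set x | exists (r : nat) (c : 'I_r -> K) (v : 'I_r -> V),
    (forall i, S (v i)) /\ x = \sum_(i < r) c i *: v i].

Lemma span_sub (S U : set V) : subspace U -> S `<=` U -> span S `<=` U.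
Proof.
move=> [U0 UD] SU _ [r [c [v [Sv ->]]]].
by apply: (big_ind U) => // [x y Ux Uy|i _];
  [rewrite -[x]scale1r; exact: UD|rewrite -[_ *: _]addr0; apply: UD => //; exact: SU].
Qed.

Lemma span_gen (S : set V) : S `<=` span S.
Proof.
move=> x Sx; exists 1%N, (fun=> 1), (fun=> x); split=> //.
by rewrite big_ord1 scale1r.
Qed.

Lemma span_subspace (S : set V) : subspace (span S).
Proof.
split; first by exists 0%N, (fun=> 0), (fun=> 0); split; [case|rewrite big_ord0].
move=> a _ _ [r [c [v [Sv ->]]]] [r' [c' [v' [Sv' ->]]]].
exists (r + r')%N,
  (fun i => match fintype.split i with inl j => a * c j | inr j => c' j end),
  (fun i => match fintype.split i with inl j => v j | inr j => v' j end).
split=> [i|]; first by case: (fintype.split i).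
rewrite big_split_ord /= scaler_sumr; congr (_ + _); apply: eq_bigr => i _.
  by rewrite -[lshift _ _]/(unsplit (inl i)) unsplitK scalerA.
by rewrite -[rshift _ _]/(unsplit (inr i)) unsplitK.
Qed.

End Span.

(* T = k[t, t^-1] enters only as the space on which operators act: a Laurent
   polynomial is the finitely supported family f of its coefficients, f n being
   that of t^n.  The regular module K^o is what makes int -> K^o a K-module. *)
Section Laurent.
Variable K : fieldType.

Definition finite_coefs : {pred int -> K^o} :=
  [pred f : int -> K^o | `[< finite_set [set n | f n != 0] >]].

Record laurent := Laurent { lcoef :> int -> K^o; _ : lcoef \in finite_coefs }.
HB.instance Definition _ := [isSub for lcoef].
HB.instance Definition _ := [Choice of laurent by <:].

Lemma finite_coefs_submod : submod_closed finite_coefs.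
Proof.
split.
  apply/asboolP; apply: sub_finite_set (finite_set0 int) => n /=.
  by rewrite eqxx.
move=> a u v /asboolP fu /asboolP fv; apply/asboolP.
have fuv : finite_set ([set n | u n != 0] `|` [set n | v n != 0]).
  by rewrite finite_setU.
apply: sub_finite_set fuv => n /= h.
have [u0|] := eqVneq (u n) 0; last by left.
right; apply: contraNneq h => v0.
by rewrite -[(a *: u + v) n]/(a * u n + v n) u0 v0 mulr0 addr0.
Qed.

HB.instance Definition _ :=
  GRing.isSubmodClosed.Build K (int -> K^o) finite_coefs finite_coefs_submod.
HB.instance Definition _ := [SubChoice_isSubLmodule of laurent by <:].

Lemma lcoefD (f g : laurent) n : (f + g) n = f n + g n.
Proof. by []. Qed.

Lemma lcoefZ a (f : laurent) n : (a *: f) n = a * f n.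
Proof. by []. Qed.

Lemma laurentP (f g : laurent) : (forall n, f n = g n) -> f = g.
Proof. by move=> fg; apply/val_inj/funext. Qed.

Fact tmul_subproof (d : int) (f : laurent) :
  (fun n => f (n - d)) \in finite_coefs.
Proof.
apply/asboolP; have /asboolP fF := valP f.
apply: sub_finite_set (finite_image (fun n => n + d) fF) => n /= h.
by exists (n - d) => //; rewrite subrK.
Qed.
Definition tmul (d : int) (f : laurent) : laurent := Laurent (tmul_subproof d f).

Fact dt_subproof (f : laurent) :
  (fun n => (n + 1)%:~R * f (n + 1)) \in finite_coefs.
Proof.
apply/asboolP; have /asboolP fF := valP f.
apply: sub_finite_set (finite_image (fun n => n - 1) fF) => n /= h.
exists (n + 1); last by rewrite addrK.
by apply: contraNneq h => ->; rewrite mulr0.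
Qed.
Definition dt (f : laurent) : laurent := Laurent (dt_subproof f).

Definition tdmon (n : int) (m : nat) : laurent -> laurent :=
  fun f => tmul n (iter m dt f).

(* Diff(T) = k[t, t^-1]<d/dt> is realised by its action on T, which is faithful
   in characteristic 0, with the t^n (d/dt)^m as a k-basis; that monomial has
   order m and degree n - m. *)
Definition diffT : set (laurent -> laurent) :=
  span [set P : laurent -> laurent | exists n m, P = tdmon n m].
Definition diffT_ord (p : nat) : set (laurent -> laurent) :=
  span [set P : laurent -> laurent | exists n m, (m <= p)%N /\ P = tdmon n m].
Definition diffT_deg (w : int) : set (laurent -> laurent) :=
  span [set P : laurent -> laurent | exists n m, n - m%:Z = w /\ P = tdmon n m].

Lemma diffT_subspace : subspace diffT.
Proof. exact: span_subspace. Qed.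

Lemma tmul_linear d : linear (tmul d).
Proof. by move=> a f g; apply: laurentP => n. Qed.

Lemma dt_linear : linear dt.
Proof.
move=> a f g; apply: laurentP => n.
by rewrite lcoefD lcoefZ /= mulrDr mulrCA.
Qed.

Lemma tdmon_linear n m : linear (tdmon n m).
Proof.
move=> a f g; rewrite /tdmon -tmul_linear; congr tmul.
by elim: m => //= m ->; exact: dt_linear.
Qed.

Lemma diffT_linear P : diffT P -> linear P.
Proof.
suff h : subspace [set P : laurent -> laurent | linear P].
  by apply: (span_sub h) => _ [n [m ->]]; exact: tdmon_linear.
split=> [a f g|c Q Q' lQ lQ' a f g]; first by rewrite scaler0 addr0.
rewrite -![(_ *: Q + _) _]/(c *: Q _ + Q' _) lQ lQ'.
by rewrite !scalerDr !scalerA mulrC addrACA.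
Qed.

Lemma diffT_tmul d P : diffT P -> diffT (tmul d \o P).
Proof.
suff h : subspace [set P : laurent -> laurent | diffT (tmul d \o P)].
  apply: (span_sub h) => _ [n [m ->]]; apply: span_gen; exists (n + d), m.
  apply/funext => f; apply: laurentP => j /=.
  by rewrite opprD [- n - d]addrC addrA.
have [h0 hD] := diffT_subspace.
split=> [|c Q Q' dQ dQ'].
  rewrite (_ : [set P : laurent -> laurent | _] 0 = diffT 0) //; congr diffT.
  by apply/funext => f; apply: laurentP.
by have := hD c _ _ dQ dQ'; congr diffT; apply/funext => f /=; rewrite tmul_linear.
Qed.

Fact leibniz_coef (g : int -> K) (n j : int) :
  (j + 1)%:~R * g (j + 1 - n) =
  n%:~R * g (j - (n - 1)) + (j - n + 1)%:~R * g (j - n + 1).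
Proof.
by rewrite opprB addrA [j - n + 1]addrAC -mulrDl -intrD [n + _]addrC subrK.
Qed.

Lemma diffT_dt P : diffT P -> diffT (dt \o P).
Proof.
have [h0 hD] := diffT_subspace.
suff h : subspace [set P : laurent -> laurent | diffT (dt \o P)].
  apply: (span_sub h) => _ [n [m ->]]; change (diffT (dt \o tdmon n m)).
  have -> : dt \o tdmon n m = n%:~R *: tdmon (n - 1) m + tdmon n m.+1.
    apply/funext => f; apply: laurentP => j.
    exact: (leibniz_coef (iter m dt f) n j).
  by apply: hD; apply: span_gen; [exists (n - 1), m|exists n, m.+1].
split=> [|c Q Q' dQ dQ'].
  rewrite (_ : [set P : laurent -> laurent | _] 0 = diffT 0) //; congr diffT.
  by apply/funext => f; apply: laurentP => j /=; rewrite mulr0.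
by have := hD c _ _ dQ dQ'; congr diffT; apply/funext => f /=; rewrite dt_linear.
Qed.

Lemma diffT_comp P Q : diffT P -> diffT Q -> diffT (P \o Q).
Proof.
move=> dP dQ; move: P dP.
suff h : subspace [set P : laurent -> laurent | diffT (P \o Q)].
  apply: (span_sub h) => _ [n [m ->]]; rewrite (_ : [set P : laurent -> laurent | _] _
    = diffT (tmul n \o (iter m dt \o Q))) //; apply: diffT_tmul.
  by elim: m => [|m IHm] //; exact: diffT_dt IHm.
have [h0 hD] := diffT_subspace.
by split=> // c P P'; exact: hD.
Qed.

Lemma diffT_id : diffT id.
Proof.
apply: span_gen; exists 0, 0%N; apply/funext => f; apply: laurentP => j /=.
by rewrite subr0.
Qed.

Fact lone_subproof : (fun n : int => (n == 0)%:R) \in finite_coefs.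
Proof.
apply/asboolP; apply: sub_finite_set (finite_set1 (0 : int)) => n.
rewrite /mkset; have [-> //|n0] := eqVneq n 0; by move=> /eqP; case.
Qed.
Definition lone : laurent := Laurent lone_subproof.

Lemma lone_neq0 : lone != 0.
Proof.
apply/eqP => /(congr1 (fun f : laurent => f 0)) /eqP.
by rewrite /= oner_eq0.
Qed.

End Laurent.

Section DiffA.
Variables (K : fieldType) (G : set nat).

Definition semigroup_algebra : set (laurent K) :=
  [set f | forall n, f n != 0 -> exists2 j : nat, G j & n = j%:Z].

Definition diffA_pred : {pred laurent K -> laurent K} :=
  [pred P : laurent K -> laurent K | `[< diffT P /\
    forall f, semigroup_algebra f -> semigroup_algebra (P f) >]].

(* D = Diff(A), identified with {P in Diff(T) : P(A) <= A}; the product is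
   composition of operators. *)
Record diffA := DiffA { dop :> laurent K -> laurent K; _ : dop \in diffA_pred }.
HB.instance Definition _ := [isSub for dop].
HB.instance Definition _ := [Choice of diffA by <:].

Lemma semigroup_algebra_subspace : subspace semigroup_algebra.
Proof.
split=> [n|c f g Af Ag n]; first by rewrite /= eqxx.
rewrite lcoefD lcoefZ; have [f0|fn _] := eqVneq (f n) 0; last exact: Af.
by rewrite f0 mulr0 add0r; exact: Ag.
Qed.

Lemma diffA_submod : submod_closed diffA_pred.
Proof.
have [d0 dD] := diffT_subspace K.
have [A0 AD] := semigroup_algebra_subspace.
split; first by apply/asboolP; split.
move=> c P Q /asboolP[dP AP] /asboolP[dQ AQ]; apply/asboolP; split.
  exact: dD.
by move=> f Af; apply: AD; [exact: AP|exact: AQ].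
Qed.

HB.instance Definition _ :=
  GRing.isSubmodClosed.Build K (laurent K -> laurent K) diffA_pred diffA_submod.
HB.instance Definition _ := [SubChoice_isSubLmodule of diffA by <:].

Lemma diffAP (P Q : diffA) : (forall f, P f = Q f) -> P = Q.
Proof. by move=> PQ; apply/val_inj/funext. Qed.

Fact diffA_one_subproof : id \in diffA_pred.
Proof. by apply/asboolP; split=> //; exact: diffT_id. Qed.
Definition diffA_one : diffA := DiffA diffA_one_subproof.

Fact diffA_mul_subproof (P Q : diffA) : P \o Q \in diffA_pred.
Proof.
have /asboolP[dP AP] := valP P; have /asboolP[dQ AQ] := valP Q.
apply/asboolP; split; first exact: diffT_comp.
by move=> f Af; apply/AP/AQ.
Qed.
Definition diffA_mul (P Q : diffA) : diffA := DiffA (diffA_mul_subproof P Q).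

Lemma diffA_linear (P : diffA) : linear P.
Proof. by have /asboolP[dP _] := valP P; exact: diffT_linear. Qed.

Fact diffA_mulA : associative diffA_mul.
Proof. by move=> P Q S; exact: diffAP. Qed.
Fact diffA_mul1r : left_id diffA_one diffA_mul.
Proof. by move=> P; exact: diffAP. Qed.
Fact diffA_mulr1 : right_id diffA_one diffA_mul.
Proof. by move=> P; exact: diffAP. Qed.
Fact diffA_mulDl : left_distributive diffA_mul +%R.
Proof. by move=> P Q S; exact: diffAP. Qed.
Fact diffA_mulDr : right_distributive diffA_mul +%R.
Proof.
move=> P Q S; apply: diffAP => f /=.
by have := diffA_linear P 1 (Q f) (S f); rewrite !scale1r.
Qed.
Fact diffA_one_neq0 : diffA_one != 0.
Proof.
apply/eqP => /(congr1 (fun P : diffA => P (lone K))) /eqP.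
exact/negP/lone_neq0.
Qed.

HB.instance Definition _ := GRing.Zmodule_isNzRing.Build diffA
  diffA_mulA diffA_mul1r diffA_mulr1 diffA_mulDl diffA_mulDr diffA_one_neq0.

Fact diffA_scaleAl (c : K) (P Q : diffA) : c *: (P * Q) = (c *: P) * Q.
Proof. exact: diffAP. Qed.
HB.instance Definition _ :=
  GRing.Lmodule_isLalgebra.Build K diffA diffA_scaleAl.
Fact diffA_scaleAr (c : K) (P Q : diffA) : c *: (P * Q) = P * (c *: Q).
Proof.
apply: diffAP => f; apply/esym.
have P0 : P 0 = 0.
  by have := diffA_linear P (-1) 0 0; rewrite scaler0 addr0 scaleN1r addNr.
have := diffA_linear P c (Q f) 0; rewrite P0 !addr0; exact.
Qed.
HB.instance Definition _ :=
  GRing.Lalgebra_isAlgebra.Build K diffA diffA_scaleAr.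

Definition Dpw (p : nat) (w : int) : set diffA :=
  [set P | diffT_ord p P /\ diffT_deg w P].

(* The sum of the subspaces D^p_w with 2p + w <= n is the span of their union. *)
Definition bernstein (n : int) : set diffA :=
  span [set P | exists p w, p%:Z *+ 2 + w <= n /\ Dpw p w P].

End DiffA.

Section Modules.
Variables (R : pzRingType) (M : lmodType R).

Definition fin_gen : Prop :=
  exists (r : nat) (g : 'I_r -> M),
    forall x, exists a : 'I_r -> R, x = \sum_(i < r) a i *: g i.

Definition cyclic : Prop := exists g : M, forall x, exists a : R, x = a *: g.

Definition submodule (N : set M) : Prop :=
  N 0 /\ forall (a : R) x y, N x -> N y -> N (a *: x + y).

(* For N and N' submodules: N'/N is simple. *)
Definition simple_step (N N' : set M) : Prop :=
  N `<` N' /\ forall L, submodule L -> N `<=` L -> L `<=` N' -> L = N \/ L = N'.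

Definition finite_length : Prop :=
  exists (l : nat) (N : nat -> set M),
    [/\ N 0%N = [set 0], N l = setT, forall i, (i <= l)%N -> submodule (N i)
      & forall i, (i < l)%N -> simple_step (N i) (N i.+1)].

End Modules.

Definition lmod_iso (R : pzRingType) (M N : lmodType R) : Prop :=
  exists f : {linear M -> N}, bijective f.

(* For an increasing filtration F by subgroups, an element of the associated graded group
   \bigoplus_n F n / F (n - 1) is represented by a finitely supported family x
   with x n in F n; two such families are identified when they agree in each
   degree n modulo F (n - 1). *)
Definition gr_elt (V : zmodType) (F : int -> set V) (x : int -> V) : Prop :=
  finite_set [set n | x n != 0] /\ forall n, F n (x n).

Definition gr_eq (V : zmodType) (F : int -> set V) (x y : int -> V) : Prop :=
  forall n, F (n - 1) (x n - y n).

Section Dimension.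
Variables (K : fieldType) (G : set nat) (M : lmodType (diffA K G)).
Local Notation D := (diffA K G).

(* The action of gr D on gr M, on representatives. *)
Definition gr_act (b : int -> D) (x : int -> M) : int -> M :=
  fun n => \sum_(j \in [set: int]) b (n - j) *: x j.

(* k acts on M through k -> D, c |-> c%:A. *)
Definition ksubspace (U : set M) : Prop :=
  U 0 /\ forall (c : K) x y, U x -> U y -> U ((c%:A : D) *: x + y).

Definition kdim (U : set M) (d : nat) : Prop :=
  exists u : 'I_d -> M, (forall i, U (u i)) /\
    forall x, U x ->
      exists! c : {ffun 'I_d -> K}, x = \sum_(i < d) (((c i)%:A : D) *: u i).

Definition filtration (F : int -> set M) : Prop :=
  [/\ forall n, ksubspace (F n),
      forall n, n < 0 -> F n = [set 0],
      forall n, F n `<=` F (n + 1),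
      forall x, exists n, F n x
    & forall m n, 0 <= m -> 0 <= n ->
        forall b x, bernstein m b -> F n x -> F (m + n) (b *: x)].

(* The second part says that gr M is finitely generated over gr D. *)
Definition good_filtration (F : int -> set M) : Prop :=
  filtration F /\
  exists (r : nat) (g : 'I_r -> int -> M), (forall i, gr_elt F (g i)) /\
    forall x, gr_elt F x ->
      exists b : 'I_r -> int -> D,
        (forall i, gr_elt (@bernstein K G) (b i)) /\
        gr_eq F x (fun n => \sum_(i < r) gr_act (b i) (g i) n).

(* d(M) = d for M nonzero: d is read off the quasi-polynomial that gives
   dim_k F n for large n, with leading coefficient e / d! in each class mod m. *)
Definition module_dim (d : nat) : Prop :=
  exists F, good_filtration F /\
  exists (m : nat) (P : 'I_m -> {poly rat}) (e : nat),
    [/\ (0 < m)%N, (0 < e)%N,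
        forall r, (size (P r) <= d.+1)%N /\ (P r)`_d = e%:R / d`!%:R
      & exists n0 : nat, forall (n : nat) (r : 'I_m), (n0 <= n)%N ->
          exists2 k : nat, kdim (F (n * m + r)%N%:Z) k & k%:R = (P r).[n%:R]].

Definition holonomic : Prop :=
  (forall x : M, x = 0) \/ ((exists x : M, x <> 0) /\ module_dim 1).

End Dimension.

(* Main.v *)
From HB Require Import structures.
From mathcomp Require Import all_boot all_order all_algebra.
From mathcomp Require Import complex.
From mathcomp Require Import boolp classical_sets functions cardinality fsbigop.
From mathcomp Require Import reals ring zify.
Require Import Defs.
Set Implicit Arguments.
Unset Strict Implicit.
Unset Printing Implicit Defensive.
Import Order.TTheory GRing.Theory Num.Theory.
Local Open Scope classical_set_scope.
Local Open Scope ring_scope.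

(** Write theta = t d/dt and let c be such that every n >= c lies in Gamma.
An operator on k[t, t^-1] is a finite sum of homogeneous operators
t^w f(theta), and it preserves A exactly when every f vanishes at the j in
Gamma with j + w outside Gamma. The multiplication rule
t^w f(theta) t^w' g(theta) = t^(w + w') f(theta + w') g(theta) then reduces all
questions about D to polynomials in one variable, and B^n becomes the span of
the t^w f(theta) in D with 2 deg f + w <= n.

The equivalence is proved as the cycle holonomic => finite length => cyclic and
not free => holonomic. Two facts about D carry it.

Simplicity. Fix s = c + 1, X = t^s and Y = t^-s q(theta) with q a product of s
linear factors whose roots are pairwise incongruent modulo s. Let W be stable
under X and Y, and N a submodule. The f for which f(theta) sends W into N form
an ideal J of k[x], stable under f(x) |-> q(x + s) f(x + s) and
f(x) |-> f(x - s) q(x). If J is not 0, then it contains 1: a common root of J could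
be followed upwards and downwards in steps of s until the progression leaves
the common roots; both ends yield roots of q, and they differ by a positive
multiple of s, which is impossible. So W lies in N (euler_torsion). Hence every nonzero
D-module is faithful (faithful): an operator killing it would yield, through
commutators with theta, a nonzero polynomial in theta killing it. Likewise no
nonzero subquotient is finite-dimensional, and the dimension of B^n v modulo N
grows at least linearly in n, at a rate that depends on D alone (growth).

Symbols. The top coefficients of P in B^n form a polynomial of degree at most n
in one variable, a dehomogenised binary form of degree n. Symbols are
multiplicative, their kernel is B^(n-1) (symbol_eq0), and for large n every
polynomial of degree at most n is a symbol (symbol_onto). So D is a domain, and
division of polynomials gives bernstein_step: for P nonzero in D there is U in
B^N whose symbol is prime to that of P, and then
B^(n+N) = U B^n + B^(n+N-d) P modulo B^(n+N-1) for large n.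

Holonomic => finite length: in a strictly increasing chain of l submodules the
linear growth of each step adds up inside a filtration whose dimensions grow
linearly, which bounds l.

Finite length => cyclic, not free: X has no left inverse, so in a simple
subquotient every element is killed by some nonzero operator, and in a module of
finite length every element is torsion because D is a domain; D itself is not.
A generator is lifted one step down a composition series at a time: if
P g = 0 and P w is not in N_i, with w in N_(i+1), then g + w generates both g
and w modulo N_i (finite_length_cyclic).

Cyclic, not free => holonomic: the generator g has a nonzero annihilator P. With
F_n = B^n g, bernstein_step gives F_(n+N) = U F_n + F_(n+N-1), so that
dim F_(n+N) - dim F_n is nonincreasing for large n, hence eventually a constant
e, and e > 0 because a nonzero module is infinite-dimensional. *)

(** * Linear independence modulo a subspace *)

Section Subspaces.
Variables (K : fieldType) (V : lmodType K).
Implicit Types (N U W : set V) (u v : nat -> V) (x y : V).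

Lemma subspaceD U x y : subspace U -> U x -> U y -> U (x + y).
Proof. by move=> [_ UD] Ux Uy; rewrite -[x]scale1r; apply: UD. Qed.

Lemma subspaceZ U a x : subspace U -> U x -> U (a *: x).
Proof. by move=> [U0 UD] Ux; rewrite -[_ *: _]addr0; apply: UD. Qed.

Lemma subspaceB U x y : subspace U -> U x -> U y -> U (x - y).
Proof.
move=> sU Ux Uy; apply: subspaceD => //.
by rewrite -scaleN1r; apply: subspaceZ.
Qed.

Lemma subspace_sum U r (F : 'I_r -> V) :
  subspace U -> (forall i, U (F i)) -> U (\sum_(i < r) F i).
Proof.
move=> sU UF; apply: (big_ind U) => //; first exact: sU.1.
by move=> x y; exact: subspaceD.
Qed.

Lemma subspace0 : subspace [set 0 : V].
Proof. by split=> // a x y -> ->; rewrite scaler0 addr0. Qed.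

(** Families are indexed by nat, with a separate length r: concatenation and
extension by one vector then need no casts between ordinal types. *)
Definition lcomb r (c : nat -> K) u : V := \sum_(i < r) c i *: u i.

Definition indep N r u : Prop :=
  forall c, N (lcomb r c u) -> forall i, (i < r)%N -> c i = 0.

Definition span_mod N r u : set V := [set x | exists c, N (x - lcomb r c u)].

Definition family_in U r u : Prop := forall i, (i < r)%N -> U (u i).

Definition cat_family r u v : nat -> V :=
  fun i => if (i < r)%N then u i else v (i - r)%N.

Lemma lcomb_in U r c u : subspace U -> family_in U r u -> U (lcomb r c u).
Proof.
move=> sU Uu; apply: subspace_sum => // i.
by apply: subspaceZ => //; apply: Uu.
Qed.

Lemma lcomb_linear r a c c' u :
  lcomb r (fun i => a * c i + c' i) u = a *: lcomb r c u + lcomb r c' u.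
Proof.
rewrite /lcomb scaler_sumr -big_split; apply: eq_bigr => i _ /=.
by rewrite scalerDl scalerA.
Qed.

Lemma lcomb_cat r r' c u v :
  lcomb (r + r') c (cat_family r u v) =
  lcomb r c u + lcomb r' (fun i => c (r + i)%N) v.
Proof.
rewrite /lcomb big_split_ord; congr (_ + _); apply: eq_bigr => i _ /=.
  by rewrite /cat_family ltn_ord.
by rewrite /cat_family ltnNge leq_addr /= addKn.
Qed.

Lemma span_mod_subspace N r u : subspace N -> subspace (span_mod N r u).
Proof.
move=> sN; split.
  exists (fun=> 0); rewrite /lcomb big1 ?subr0; first by exact: sN.1.
  by move=> i _; rewrite scale0r.
move=> a x y [c Nx] [c' Ny]; exists (fun i => a * c i + c' i).
rewrite lcomb_linear opprD addrACA -scalerBr.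
by apply: subspaceD => //; apply: subspaceZ.
Qed.

Lemma span_mod_base N r u : subspace N -> N `<=` span_mod N r u.
Proof.
move=> sN x Nx; exists (fun=> 0); rewrite /lcomb big1 ?subr0 // => i _.
by rewrite scale0r.
Qed.

Lemma span_mod_family N r u : subspace N -> family_in (span_mod N r u) r u.
Proof.
move=> sN i ir; exists (fun j => (j == i)%:R).
rewrite /lcomb (bigD1 (Ordinal ir)) //= eqxx scale1r big1 => [|j].
  by rewrite addr0 subrr; exact: sN.1.
by rewrite -val_eqE /= => /negPf ->; rewrite scale0r.
Qed.

Lemma span_mod_min N r u W :
  subspace W -> N `<=` W -> family_in W r u -> span_mod N r u `<=` W.
Proof.
move=> sW NW Wu x [c Nx]; rewrite -[x](subrK (lcomb r c u)).
by apply: subspaceD => //; [apply: NW|apply: lcomb_in].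
Qed.

(** The tool for adding up dimensions along a chain N <= W: vectors of W that are
independent modulo N, followed by vectors independent modulo W. If a combination
of all of them lies in N, the second half of it lies in W, so its coefficients
vanish first. *)
Lemma indep_cat N W r r' u v :
  subspace W -> N `<=` W -> family_in W r u ->
  indep N r u -> indep W r' v -> indep N (r + r') (cat_family r u v).
Proof.
move=> sW NW Wu iu iv c; rewrite lcomb_cat => Nc.
have cv : forall i, (i < r')%N -> c (r + i)%N = 0.
  apply: (iv (fun i => c (r + i)%N)).
  rewrite -[lcomb r' _ _](addKr (lcomb r c u)) addrC.
  by apply: subspaceB => //; [apply: NW|apply: lcomb_in].
rewrite [X in _ + X]big1 ?addr0 in Nc; last first.
  by move=> i _; rewrite cv ?scale0r.
move=> i lti; have [ir|ri] := ltnP i r; first exact: iu ir.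
by rewrite -(subnKC ri); apply: cv; rewrite ltn_subLR.
Qed.

Lemma indep1 W x : subspace W -> ~ W x -> indep W 1 (fun=> x).
Proof.
move=> sW nWx c; rewrite /lcomb big_ord1 => Wc i.
rewrite ltnS leqn0 => /eqP ->; apply/eqP; apply/negPn/negP => c0; apply: nWx.
by rewrite -[x]scale1r -(mulVf c0) -scalerA; apply: subspaceZ.
Qed.

Lemma family_cat U r r' u v :
  family_in U r u -> family_in U r' v ->
  family_in U (r + r') (cat_family r u v).
Proof.
move=> Uu Uv i lti; rewrite /cat_family; case: ltnP => [/Uu //|ri].
by apply: Uv; rewrite ltn_subLR.
Qed.

(** More rows than columns: the row kernel of the matrix is not zero. *)
Lemma dependent_rows r d (A : nat -> nat -> K) : (d < r)%N ->
  exists c : nat -> K, (exists2 i, (i < r)%N & c i != 0) /\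
    forall j, (j < d)%N -> \sum_(i < r) c i * A i j = 0.
Proof.
move=> ltdr; pose B : 'M[K]_(r, d) := \matrix_(i, j) A i j.
have /rowV0Pn[w /sub_kermxP wB w0] : kermx B != 0.
  rewrite -mxrank_eq0 mxrank_ker subn_eq0 -ltnNge.
  exact: leq_ltn_trans (rank_leq_col B) ltdr.
have [i wi] : exists i, w 0 i != 0.
  apply/existsP; rewrite -negb_forall; apply: contraNN w0 => /forallP w0.
  by apply/eqP/rowP => i; rewrite mxE; apply/eqP.
exists (fun k => if insub k is Some j then w 0 j else 0).
split; first by exists i => //; rewrite valK.
move=> j ltj; have /rowP/(_ (Ordinal ltj)) := wB; rewrite !mxE; apply: etrans.
by apply: eq_bigr => k _; rewrite valK !mxE.
Qed.

(** Bounds dimensions from above without exhibiting a spanning family: d linear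
forms that separate the vectors of U modulo N are enough. *)
Lemma indep_le_coords N U r d u (psi : nat -> V -> K) :
  subspace U -> family_in U r u -> indep N r u ->
  (forall j a x y, psi j (a *: x + y) = a * psi j x + psi j y) ->
  (forall x, U x -> (forall j, (j < d)%N -> psi j x = 0) -> N x) ->
  (r <= d)%N.
Proof.
move=> sU Uu iu psiD psi0; rewrite leqNgt; apply/negP => ltdr.
have [c [[i ir /eqP ci] cA]] := dependent_rows (fun i j => psi j (u i)) ltdr.
apply/ci/iu => //; apply: psi0 => [|j jd]; first exact: lcomb_in.
rewrite -(cA j jd) /lcomb.
have psi00 : psi j 0 = 0.
  by have := psiD j (-1) 0 0; rewrite scaler0 addr0 mulN1r addNr.
elim/big_rec2: _ => // k y x _ <-.
by rewrite psiD.
Qed.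

(** Steinitz exchange, in the form that compares sizes only. *)
Lemma indep_le_span N r d u v :
  subspace N -> family_in (span_mod N d v) r u -> indep N r u -> (r <= d)%N.
Proof.
move=> sN uv iu; rewrite leqNgt; apply/negP => ltdr.
have /choice[A Au] : forall i, exists c : nat -> K,
    (i < r)%N -> N (u i - lcomb d c v).
  move=> i; have [ir|_] := boolP (i < r)%N; last by exists (fun=> 0).
  by have [c Nc] := uv i ir; exists c.
have [c [[i ir /eqP ci] cA]] := dependent_rows A ltdr.
apply/ci/iu => //.
have -> : lcomb r c u = lcomb r c (fun i => u i - lcomb d (A i) v).
  apply/eqP; rewrite -subr_eq0 /lcomb -sumrB.
  have e (k : 'I_r) : c k *: u k - c k *: (u k - lcomb d (A k) v) =
      \sum_(j < d) c k *: (A k j *: v j).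
    by rewrite -scalerBr opprB addrCA subrr addr0 scaler_sumr.
  under eq_bigr => k _ do rewrite e.
  rewrite exchange_big big1 //= => j _.
  under eq_bigr => k _ do rewrite scalerA.
  by rewrite -scaler_suml cA ?scale0r.
by apply: lcomb_in.
Qed.

(** A family of maximal length spans: any vector outside its span could be appended
to it. *)
Lemma exists_basis_mod N U b : subspace N -> subspace U ->
  (forall r u, family_in U r u -> indep N r u -> (r <= b)%N) ->
  exists r u, [/\ family_in U r u, indep N r u & U `<=` span_mod N r u].
Proof.
move=> sN sU bU.
pose P r := `[< exists2 u, family_in U r u & indep N r u >].
have P0 : exists r, P r.
  by exists 0%N; apply/asboolP; exists (fun=> 0).
have Pb r : P r -> (r <= b)%N by move=> /asboolP[u]; exact: bU.
case: (ex_maxnP P0 Pb) => r /asboolP[u Uu iu] rmax.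
exists r, u; split=> // x Ux; apply: contrapT => nx.
suff /rmax : P (r + 1)%N by rewrite addn1 ltnn.
apply/asboolP; exists (cat_family r u (fun=> x)); first exact: family_cat.
apply: (@indep_cat _ (span_mod N r u)) => //.
- exact: span_mod_subspace.
- exact: span_mod_base.
- exact: span_mod_family.
- by apply: indep1 => //; exact: span_mod_subspace.
Qed.

Definition has_dim U d : Prop :=
  exists u, [/\ family_in U d u, indep [set 0] d u & U `<=` span_mod [set 0] d u].

Lemma indep_le_dim U d r u :
  has_dim U d -> family_in U r u -> indep [set 0] r u -> (r <= d)%N.
Proof.
move=> [v [_ _ Uv]] Uu; apply: (@indep_le_span _ _ _ _ v subspace0).
by move=> i ir; apply/Uv/Uu.
Qed.

End Subspaces.

(** phi maps U1 / U0 onto (W0 + W1) / W0, so dim W1 - dim W0 <= dim U1 - dim U0.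
Applied to a filtration F_n = B^n g and the action phi of an operator U in B^N,
this makes the Hilbert function nonincreasing along steps of length N. *)
Lemma dim_step (K : fieldType) (V : lmodType K) (U0 U1 W0 W1 : set V)
    (d0 d1 e0 e1 : nat) (phi : V -> V) :
  (forall a x y, phi (a *: x + y) = a *: phi x + phi y) ->
  subspace U0 -> subspace U1 -> subspace W0 -> U0 `<=` U1 ->
  has_dim U0 d0 -> has_dim U1 d1 -> has_dim W0 e0 -> has_dim W1 e1 ->
  (forall x, U0 x -> W0 (phi x)) ->
  (forall y, W1 y -> exists2 x, U1 x & W0 (y - phi x)) ->
  (e1 + d0 <= e0 + d1)%N.
Proof.
move=> phiD sU0 sU1 sW0 U01 [u0 [U0u iu0 U0s]] dU1 [w0 [W0w iw0 W0s]].
move=> [w1 [W1w iw1 _]] phiU W1phi.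
have U0_0 : [set 0] `<=` U0 by move=> _ ->; exact: sU0.1.
have [r [s [U1s is_ U1sp]]] : exists r s,
    [/\ family_in U1 r s, indep U0 r s & U1 `<=` span_mod U0 r s].
  apply: (@exists_basis_mod _ _ _ _ d1) => // r u Uu iu.
  by apply: (indep_le_dim dU1 Uu) => c /U0_0; exact: iu.
have d01 : (d0 + r <= d1)%N.
  apply: (indep_le_dim (u := cat_family d0 u0 s) dU1).
    by apply: family_cat => // i /U0u /U01.
  exact: indep_cat iu0 is_.
suff : (e1 <= e0 + r)%N by lia.
have s0 := @subspace0 K V.
pose v := cat_family e0 w0 (phi \o s).
have sT := span_mod_subspace (e0 + r) v s0.
have vT := @span_mod_family _ _ _ (e0 + r)%N v s0.
have W0T : W0 `<=` span_mod [set 0] (e0 + r) v.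
  move=> x /W0s; apply: span_mod_min => //; first exact: span_mod_base.
  move=> i ie; have -> : w0 i = v i by rewrite /v /cat_family ie.
  exact/vT/ltn_addr.
have phiT x : U1 x -> span_mod [set 0] (e0 + r) v (phi x).
  move=> /U1sp[c U0x].
  have -> : phi x = phi (x - lcomb r c s) + phi (lcomb r c s).
    by have := phiD 1 (x - lcomb r c s) (lcomb r c s); rewrite !scale1r subrK.
  apply: subspaceD => //; first exact/W0T/phiU.
  have -> : phi (lcomb r c s) = lcomb r c (phi \o s).
    have phi0 : phi 0 = 0.
      by have := phiD (-1) 0 0; rewrite !scaler0 addr0 scaleN1r addNr.
    by rewrite /lcomb; elim/big_rec2: _ => // k y z _ <-; rewrite phiD.
  apply: lcomb_in => // i ir; have -> : (phi \o s) i = v (e0 + i)%N.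
    by rewrite /v /cat_family ltnNge leq_addr /= addKn.
  by apply: vT; rewrite ltn_add2l.
apply: (@indep_le_span _ _ [set 0] _ _ w1 v) => // i ie.
have [x U1x W0y] := W1phi _ (W1w i ie).
rewrite -[w1 i](subrK (phi x)).
by apply: subspaceD => //; [exact: W0T|exact: phiT].
Qed.

(** * Homogeneous operators on Laurent polynomials *)

Section Homogeneous.
Variable K : numFieldType.
Implicit Types (f g : {poly K}) (w j n : int) (P Q : laurent K -> laurent K).

Lemma poly_eq0_nat f : (forall i : nat, f.[i%:R] = 0) -> f = 0.
Proof.
move=> f0; apply: contrapT => /eqP fn0.
pose rs := [seq i%:R : K | i <- iota 0 (size f)].
have : (size rs < size f)%N.
  apply: max_poly_roots => //; first by apply/allP => _ /mapP[i _ ->]; apply/eqP.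
  by rewrite map_inj_uniq ?iota_uniq // => i i' /eqP; rewrite eqr_nat => /eqP.
by rewrite size_map size_iota ltnn.
Qed.

Lemma poly_eq_int f g : (forall j, f.[j%:~R] = g.[j%:~R]) -> f = g.
Proof.
move=> fg; apply/eqP; rewrite -subr_eq0; apply/eqP/poly_eq0_nat => i.
by rewrite hornerD hornerN -[i%:R]/(i%:Z%:~R) fg subrr.
Qed.

(** hop w f is t^w f(theta), with theta = t d/dt: it sends t^j to f(j) t^(j + w). *)
Fact hop_subproof w f (g : laurent K) :
  (fun n => f.[(n - w)%:~R] * g (n - w) : K^o) \in @finite_coefs K.
Proof.
apply/asboolP; have /asboolP gF := valP (tmul w g).
by apply: sub_finite_set gF => n /=; apply: contraNneq => ->; rewrite mulr0.
Qed.
Definition hop w f : laurent K -> laurent K :=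
  fun h => Laurent (hop_subproof w f h).

Lemma hop_linear w a f g : hop w (a *: f + g) = a *: hop w f + hop w g.
Proof.
apply/funext => h; apply: laurentP => n.
by rewrite /= hornerD hornerZ mulrDl -mulrA.
Qed.

(** f(theta) t^w = t^w f(theta + w), so shifts of the variable record the
noncommutativity. *)
Definition shiftp w f : {poly K} := f \Po ('X + w%:~R%:P).

Lemma horner_shiftp w f x : (shiftp w f).[x] = f.[x + w%:~R].
Proof. by rewrite horner_comp !hornerE. Qed.

Lemma hop_comp w w' f g : hop w f \o hop w' g = hop (w + w') (shiftp w' f * g).
Proof.
apply/funext => h; apply: laurentP => n.
rewrite /= opprD addrA hornerM horner_shiftp -mulrA; congr (f.[_] * _).
by rewrite -intrD subrK.
Qed.

Lemma shiftp_eq0 w f : (shiftp w f == 0) = (f == 0).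
Proof. by rewrite comp_poly2_eq0 ?size_XaddC. Qed.

Lemma size_shiftp w f : size (shiftp w f) = size f.
Proof. by rewrite size_comp_poly2 ?size_XaddC. Qed.

Lemma lead_coef_shiftp w f : lead_coef (shiftp w f) = lead_coef f.
Proof.
by rewrite lead_coef_comp ?size_XaddC // lead_coefXaddC expr1n mulr1.
Qed.

(** The falling factorial: t^m (d/dt)^m = theta (theta - 1) ... (theta - m + 1). *)
Fixpoint ffact m : {poly K} :=
  if m is m'.+1 then ('X - m'%:R%:P) * ffact m' else 1.

Lemma ffact_monic m : ffact m \is monic /\ size (ffact m) = m.+1.
Proof.
elim: m => [|m [mf sf]] /=; first by rewrite monic1 size_poly1.
have mX := monicXsubC (m%:R : K).
split; first by rewrite monicMl.
by rewrite size_monicM ?monic_neq0 // sf size_XsubC.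
Qed.

Lemma tdmon_hop n m : @tdmon K n m = hop (n - m%:Z) (ffact m).
Proof.
have e (g : laurent K) : iter m (@dt K) g = hop (- m%:Z) (ffact m) g.
  elim: m => [|m IH] /=.
    by apply: laurentP => j /=; rewrite hornerC mul1r oppr0 subr0.
  rewrite IH; apply: laurentP => j /=; rewrite hornerM hornerXsubC !opprK.
  have -> : j + 1 + m%:Z = j + m.+1%:Z by lia.
  rewrite mulrA; congr (_ * _ * _); rewrite -[m%:R]/(m%:Z%:~R) -intrB.
  by congr (_%:~R); lia.
apply/funext => g; rewrite /tdmon e; apply: laurentP => j /=.
by congr (_.[_%:~R] * lcoef g _); lia.
Qed.

(** The falling factorials of degree < p span the polynomials of degree < p. Both
the order bound and the degree are kept, since D^p_w is cut out by the two
together. *)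
Lemma hop_span w p f : (size f <= p)%N ->
  span [set P | exists n m, [/\ (m < p)%N, n - m%:Z = w & P = @tdmon K n m]]
    (hop w f).
Proof.
elim: p f => [|p IH] f sf.
  move: sf; rewrite leqn0 size_poly_eq0 => /eqP ->.
  rewrite (_ : hop w 0 = 0); first exact: (span_subspace _).1.
  by apply/funext => g; apply: laurentP => j /=; rewrite horner0 mul0r.
have [mfp sfp] := ffact_monic p.
have sub : span [set P | exists n m, [/\ (m < p)%N, n - m%:Z = w & P = @tdmon K n m]]
    `<=` span [set P | exists n m, [/\ (m < p.+1)%N, n - m%:Z = w & P = @tdmon K n m]].
  apply: span_sub; first exact: span_subspace.
  move=> _ [n [m [mp nm ->]]]; apply: span_gen; exists n, m; split=> //.
  exact: ltnW.
have -> : f = f`_p *: ffact p + (f - f`_p *: ffact p) by rewrite addrC subrK.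
rewrite hop_linear; apply: (span_subspace _).2.
  apply: span_gen; exists (w + p%:Z), p; split=> //; first by rewrite addrK.
  by rewrite tdmon_hop addrK.
apply/sub/IH/leq_sizeP => j pj; rewrite coefB coefZ.
have [->|jp] := eqVneq j p.
  by have := monicP mfp; rewrite lead_coefE sfp /= => ->; rewrite mulr1 subrr.
have pj' : (p < j)%N by rewrite ltn_neqAle eq_sym jp.
rewrite (nth_default 0 (leq_trans sf pj')) [(ffact p)`_j]nth_default ?sfp //.
by rewrite mulr0 subrr.
Qed.

Lemma diffT_hop w f : diffT (hop w f).
Proof.
apply: (span_sub (diffT_subspace K)) (hop_span w (leqnn (size f))).
by move=> _ [n [m [_ _ ->]]]; apply: span_gen; exists n, m.
Qed.

Definition mon j : laurent K := tmul j (lone K).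

Lemma lcoef_mon j n : mon j n = (n == j)%:R.
Proof. by rewrite /= subr_eq0. Qed.

(** f is the polynomial of the degree-w part t^w f(theta) of P. It is read off the
action on monomials, which determines f since k is infinite. *)
Definition has_component P w f := forall j, P (mon j) (j + w) = f.[j%:~R].

Lemma has_component_hop w f w' : has_component (hop w f) w' (if w' == w then f else 0).
Proof.
move=> j; rewrite -[LHS]/(f.[_] * mon j (j + w' - w)) lcoef_mon.
rewrite -addrA -subr_eq0 addrAC subrr add0r subr_eq0.
case: eqP => [->|_]; first by rewrite subrr addr0 mulr1.
by rewrite mulr0 horner0.
Qed.

Lemma has_component_uniq P w f g : has_component P w f -> has_component P w g -> f = g.
Proof. by move=> Pf Pg; apply: poly_eq_int => j; rewrite -Pf -Pg. Qed.

Lemma has_component_linear P Q w a f g : has_component P w f -> has_component Q w g ->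
  has_component (a *: P + Q) w (a *: f + g).
Proof.
move=> Pf Qg j; rewrite hornerD hornerZ -Pf -Qg.
by [].
Qed.

Lemma diffT_component_exists P w : diffT P -> exists f, has_component P w f.
Proof.
move: P; apply: span_sub => [|_ [n [m ->]]].
  split; first by exists 0 => j; rewrite horner0.
  move=> a P Q [f Pf] [g Qg]; exists (a *: f + g); exact: has_component_linear.
by rewrite tdmon_hop; eexists; exact: has_component_hop.
Qed.

Definition component P w : {poly K} := xget 0 [set f | has_component P w f].

Lemma componentP P w : diffT P -> has_component P w (component P w).
Proof.
by move=> /(diffT_component_exists w)[f Pf]; rewrite /component; case: xgetP => // /(_ f).
Qed.

Lemma component_eq P w f : has_component P w f -> component P w = f.
Proof.
move=> Pf; apply: (@has_component_uniq P w) => //; rewrite /component.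
by case: xgetP => // /(_ f).
Qed.

Lemma component_hop w f w' : component (hop w f) w' = if w' == w then f else 0.
Proof. exact/component_eq/has_component_hop. Qed.

Lemma component_linear P Q w a : diffT P -> diffT Q ->
  component (a *: P + Q) w = a *: component P w + component Q w.
Proof. by move=> dP dQ; apply/component_eq/has_component_linear; exact: componentP. Qed.

Lemma component_zero w : component (0 : laurent K -> laurent K) w = 0.
Proof. by apply: component_eq => j; rewrite horner0. Qed.

Lemma lsum_coef (I : Type) (s : seq I) (F : I -> laurent K) n :
  (\sum_(i <- s) F i) n = \sum_(i <- s) F i n :> K.
Proof. by elim/big_rec2: _ => // i x y _ <-. Qed.

Lemma laurent_expand (g : laurent K) : exists s : seq int,
  g = \sum_(n <- s) (g n : K) *: mon n.
Proof.
have /asboolP/finite_seqP[s gs] := valP g.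
exists (undup s); apply: laurentP => j; rewrite lsum_coef.
have e n : ((g n : K) *: mon n) j = (g n : K) * (j == n)%:R :> K.
  by rewrite lcoefZ lcoef_mon.
under eq_bigr => n _ do rewrite e.
have [js|js] := boolP (j \in undup s).
  rewrite (bigD1_seq j) ?undup_uniq //= eqxx mulr1 big1 ?addr0 //.
  by move=> n; rewrite eq_sym => /negPf ->; rewrite mulr0.
rewrite big1_seq.
  apply/eqP/negPn/negP => gj; move: js; rewrite mem_undup => /negP; apply.
  by have : [set` s] j by rewrite -gs.
move=> n /= ns; case: eqP => [jn|_]; last by rewrite mulr0.
by rewrite -jn (negPf js) in ns.
Qed.

(** A linear operator is determined by its values on the t^j. *)
Lemma diffT_ext P Q : diffT P -> diffT Q -> (forall w, component P w = component Q w) ->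
  P = Q.
Proof.
move=> dP dQ PQ.
have monPQ j : P (mon j) = Q (mon j).
  apply: laurentP => n; rewrite -(subrK j n) addrC.
  by rewrite (componentP _ dP) (componentP _ dQ) PQ.
have lin0 (L : laurent K -> laurent K) : linear L -> L 0 = 0.
  by move=> lL; have := lL (-1) 0 0; rewrite !scaler0 addr0 scaleN1r addNr.
apply/funext => g; have [s ->] := laurent_expand g.
have lP := diffT_linear dP; have lQ := diffT_linear dQ.
elim: s => [|n s IH]; first by rewrite !big_nil !lin0.
by rewrite !big_cons lP lQ IH monPQ.
Qed.

Lemma diffT_component_support P : diffT P ->
  exists s : seq int, forall w, w \notin s -> component P w = 0.
Proof.
suff h P' : diffT P' -> diffT P' /\
    exists s : seq int, forall w, w \notin s -> component P' w = 0.
  by move=> /h[].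
have [d0 dD] := diffT_subspace K.
move: P'; apply: span_sub => [|_ [n [m ->]]].
  split.
    split=> //; exists [::] => w _; apply: component_eq => j.
    by rewrite horner0.
  move=> a P' Q [dP [s Ps]] [dQ [s' Qs]]; split; first exact: dD.
  exists (s ++ s') => w; rewrite mem_cat negb_or => /andP[ws ws'].
  by rewrite component_linear // Ps // Qs // scaler0 addr0.
rewrite tdmon_hop; split; first exact: diffT_hop.
exists [:: n - m%:Z] => w; rewrite inE component_hop.
by move=> /negPf ->.
Qed.

End Homogeneous.

(** * Homogeneous components in D and the Bernstein filtration *)

Section Components.
Variables (K : numFieldType) (G : set nat).
Local Notation D := (diffA K G).
Implicit Types (f g : {poly K}) (w n : int) (P Q : D).

(** The condition for t^w f(theta) to preserve A. *)
Definition admissible w f : Prop := forall j : nat, G j ->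
  (forall i : nat, G i -> j%:Z + w <> i%:Z) -> f.[j%:R] = 0.

Lemma diffA_diffT P : diffT P.
Proof. by have /asboolP[] := valP P. Qed.

Lemma hop_stable w f : admissible w f ->
  forall h : laurent K, semigroup_algebra G h -> semigroup_algebra G (hop w f h).
Proof.
move=> gf h Ah n; rewrite /= mulf_eq0 negb_or => /andP[fn hn].
have [j Gj nj] := Ah _ hn; apply: contrapT => nG; move/eqP: fn; apply.
rewrite nj; apply: gf => // i Gi ji; apply: nG; exists i => //; lia.
Qed.

(** The operator t^w f(theta) of D, made total: it is 0 when f is not admissible. *)
Definition homog w f : D := insubd 0 (hop w f).

Lemma homogE w f : admissible w f -> \val (homog w f) = hop w f.
Proof.
move=> gf; rewrite insubdK //; apply/asboolP; split; first exact: diffT_hop.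
exact: hop_stable.
Qed.

(** P preserves A, so the coefficient f(j) of t^(j + w) in P t^j must vanish when
j is in Gamma and j + w is not. Hence the homogeneous components of an operator
in D are again in D. *)
Lemma component_admissible P w : admissible w (component P w).
Proof.
move=> j Gj nG; have /asboolP[dP AP] := valP P.
apply/eqP/negPn/negP => fj.
have Am : semigroup_algebra G (mon K j).
  move=> n; rewrite lcoef_mon; have [-> _|_ /eqP //] := eqVneq n j%:Z; by exists j.
have [|i Gi ji] := AP _ Am (j%:Z + w); first by rewrite (componentP _ dP).
exact: nG ji.
Qed.

Lemma admissible_linear w a f g : admissible w f -> admissible w g -> admissible w (a *: f + g).
Proof.
by move=> gf gg j Gj nG; rewrite hornerD hornerZ gf // gg // mulr0 addr0.
Qed.

Lemma admissible_mull w f g : admissible w g -> admissible w (f * g).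
Proof. by move=> gg j Gj nG; rewrite hornerM gg // mulr0. Qed.

Lemma admissible0 f : admissible 0 f.
Proof. by move=> j Gj /(_ j Gj); rewrite addr0. Qed.

Lemma component_homog w f w' : admissible w f ->
  component (homog w f) w' = if w' == w then f else 0.
Proof. by move=> gf; rewrite (homogE gf) component_hop. Qed.

Lemma componentD_linear w a P Q :
  component (a *: P + Q) w = a *: component P w + component Q w.
Proof.
rewrite -(component_linear w a (diffA_diffT P) (diffA_diffT Q)).
by [].
Qed.

Lemma component0 w : component (0 : D) w = 0.
Proof. exact: component_zero. Qed.

Lemma component_sum w (I : Type) (s : seq I) (F : I -> D) :
  component (\sum_(i <- s) F i) w = \sum_(i <- s) component (F i) w.
Proof.
elim/big_rec2: _ => [|i x y _ <-]; first exact: component0.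
by have := componentD_linear w 1 (F i) y; rewrite !scale1r.
Qed.

Lemma diffA_ext P Q : (forall w, component P w = component Q w) -> P = Q.
Proof.
move=> PQ; apply: val_inj; apply: diffT_ext => //; exact: diffA_diffT.
Qed.

Lemma homog_linear w a f g : admissible w f -> admissible w g ->
  homog w (a *: f + g) = a *: homog w f + homog w g.
Proof.
move=> gf gg; apply: diffA_ext => w'.
rewrite componentD_linear !component_homog //; last exact: admissible_linear.
by case: eqP => // _; rewrite scaler0 addr0.
Qed.

Lemma homog0 w : homog w 0 = 0.
Proof.
apply: diffA_ext => w'; rewrite component_homog ?component0 ?if_same // => j _ _.
by rewrite horner0.
Qed.

Lemma admissible_mul w w' f g :
  admissible w f -> admissible w' g -> admissible (w + w') (shiftp w' f * g).
Proof.
move=> gf gg j Gj nG; rewrite hornerM horner_shiftp.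
have [[i Gi ji]|nGi] := pselect (exists2 i : nat, G i & j%:Z + w' = i%:Z).
  rewrite -[j%:R]/(j%:Z%:~R) -intrD ji gf ?mul0r // => i' Gi' ii'.
  by apply: nG Gi' _; rewrite addrCA ji addrC.
by rewrite gg ?mulr0 // => i Gi ji; apply: nGi; exists i.
Qed.

Lemma homog_mul w w' f g : admissible w f -> admissible w' g ->
  homog w f * homog w' g = homog (w + w') (shiftp w' f * g).
Proof.
move=> gf gg; apply: val_inj; rewrite (homogE (admissible_mul gf gg)) -hop_comp.
by rewrite -(homogE gf) -(homogE gg).
Qed.

Lemma diffA_decomp P :
  exists2 s : seq int, uniq s & P = \sum_(w <- s) homog w (component P w).
Proof.
have [s Ps] := diffT_component_support (diffA_diffT P).
exists (undup s); first exact: undup_uniq.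
apply: diffA_ext => w; rewrite component_sum.
under eq_bigr => w' _ do rewrite (component_homog _ (@component_admissible P w')).
have [ws|ws] := boolP (w \in undup s).
  rewrite (bigD1_seq w) ?undup_uniq //= eqxx big1 ?addr0 // => w'.
  by rewrite eq_sym => /negPf ->.
rewrite big1_seq; first by apply: Ps; rewrite -mem_undup.
move=> w' /= ws'; case: eqP => // ww'.
by rewrite -ww' (negPf ws) in ws'.
Qed.

Lemma degree_le_weight n w f : f != 0 ->
  (forall i : nat, n < i%:Z *+ 2 + w -> f`_i = 0) ->
  (size f).-1%:Z *+ 2 + w <= n.
Proof.
move=> f0 fn; rewrite leNgt; apply/negP => /fn /eqP; apply/negP.
by rewrite -lead_coefE lead_coef_eq0.
Qed.

(** The working description of B^n: t^w f(theta) has order deg f, so it lies in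
B^n if and only if 2 deg f + w <= n, and this is checked on each component
separately. *)
Lemma bernsteinP n P : bernstein n P <->
  forall w (i : nat), n < i%:Z *+ 2 + w -> (component P w)`_i = 0.
Proof.
have Bs := span_subspace [set P : D | exists p w, p%:Z *+ 2 + w <= n /\ Dpw p w P].
split.
  move: P; apply: span_sub.
    split=> [w i _|a P Q hP hQ w i ni]; first by rewrite component0 coef0.
    by rewrite componentD_linear coefD coefZ hP // hQ // mulr0 addr0.
  move=> P [p [w [le_n [oP dP]]]] w' i ni.
  have hord (P' : laurent K -> laurent K) : diffT_ord p P' ->
      diffT P' /\ forall w i, (p < i)%N -> (component P' w)`_i = 0.
    move: P'; apply: span_sub => [|_ [n' [m [mp ->]]]].
      have [d0 dD] := diffT_subspace K.
      split=> [|a P' Q' [dP' hP] [dQ hQ]].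
        by split=> // w'' i' _; rewrite component_zero coef0.
      split=> [|w'' i' pi']; first exact: dD.
      by rewrite component_linear // coefD coefZ hP // hQ // mulr0 addr0.
    split=> [|w'' i' pi']; first by rewrite tdmon_hop; exact: diffT_hop.
    rewrite tdmon_hop component_hop; case: eqP => _; last by rewrite coef0.
    by rewrite nth_default // (ffact_monic K m).2; exact: leq_ltn_trans mp _.
  have hdeg (P' : laurent K -> laurent K) : diffT_deg w P' ->
      diffT P' /\ forall w', w' != w -> component P' w' = 0.
    move: P'; apply: span_sub => [|_ [n' [m [nm ->]]]].
      have [d0 dD] := diffT_subspace K.
      split=> [|a P' Q' [dP' hP] [dQ hQ]].
        by split=> // w'' _; rewrite component_zero.
      split=> [|w'' ww]; first exact: dD.
      by rewrite component_linear // hP // hQ // scaler0 addr0.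
    split=> [|w'' /negPf ww]; first by rewrite tdmon_hop; exact: diffT_hop.
    by rewrite tdmon_hop component_hop nm ww.
  have [ww|ww] := eqVneq w' w; last by rewrite (hdeg _ dP).2 // coef0.
  by apply: (hord _ oP).2; rewrite -ltz_nat; lia.
move=> hP; have [s us ->] := diffA_decomp P.
apply: (big_ind (bernstein n)); first exact: Bs.1.
  by move=> x y Bx By; exact: subspaceD.
move=> w _; have [->|c0] := eqVneq (component P w) 0.
  by rewrite homog0; exact: Bs.1.
have gP := @component_admissible P w.
have sz : (0 < size (component P w))%N by rewrite size_poly_gt0.
apply: span_gen; exists (size (component P w)).-1, w; split.
  by apply: degree_le_weight => // i; exact: hP.
have hs := @hop_span K w (size (component P w)) _ (leqnn _).
split; rewrite -[dop _]/(\val _) (homogE gP).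
  apply: (span_sub (span_subspace _)) hs => _ [n' [m [mp _ ->]]].
  by apply: span_gen; exists n', m; split=> //; rewrite -ltnS prednK.
apply: (span_sub (span_subspace _)) hs => _ [n' [m [_ nm ->]]].
by apply: span_gen; exists n', m.
Qed.

Lemma bernstein_homog n w f : admissible w f ->
  (forall i : nat, n < i%:Z *+ 2 + w -> f`_i = 0) -> bernstein n (homog w f).
Proof.
move=> gf fn; apply/bernsteinP => w' i; rewrite component_homog //.
by case: eqP => [->|_ _]; [exact: fn|rewrite coef0].
Qed.

Lemma bernstein_subspace n : subspace (@bernstein K G n).
Proof. exact: span_subspace. Qed.

Lemma bernstein_exhausts P : exists n : nat, bernstein n%:Z P.
Proof.
have [s _ Ps] := diffA_decomp P.
have [N sN] : exists N : nat, forall w, w \in s ->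
    (size (component P w))%:Z *+ 2 + w <= N%:Z.
  elim: {Ps}s => [|w s [N IH]]; first by exists 0%N.
  exists (N + absz ((size (component P w))%:Z *+ 2 + w)%R)%N => w'.
  rewrite inE => /orP[/eqP ->|/IH wN]; last first.
    by apply: le_trans wN _; rewrite lez_nat leq_addr.
  by rewrite PoszD abszE; apply: le_trans (ler_norm _) _; rewrite lerDr.
exists N; rewrite {1}Ps; have Bs := bernstein_subspace N%:Z.
rewrite big_seq; apply: (big_ind (bernstein N%:Z)); first exact: Bs.1.
  by move=> x y; exact: subspaceD.
move=> w ws; apply: bernstein_homog => [|i Ni]; first exact: component_admissible.
by apply: nth_default; have := sN w ws; set k := size _; lia.
Qed.

Lemma bernstein_le m n P : m <= n -> bernstein m P -> bernstein n P.
Proof.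
move=> mn /bernsteinP BP; apply/bernsteinP => w i ni.
by apply: BP; exact: le_lt_trans ni.
Qed.

(** As B^n is spanned by its homogeneous elements, statements linear in P need only
be checked on them. *)
Lemma bernstein_ind n (S : set D) : subspace S ->
  (forall w f, admissible w f -> (forall i : nat, n < i%:Z *+ 2 + w -> f`_i = 0) ->
    S (homog w f)) -> bernstein n `<=` S.
Proof.
move=> sS Shomog P /bernsteinP BP; have [s _ ->] := diffA_decomp P.
apply: (big_ind S); first exact: sS.1.
  by move=> x y; exact: subspaceD.
move=> w _; apply: Shomog; first exact: component_admissible.
by move=> i; exact: BP.
Qed.

Lemma bernstein_mul m n P Q :
  bernstein m P -> bernstein n Q -> bernstein (m + n) (P * Q).
Proof.
have Bs := bernstein_subspace (m + n).
move=> BP BQ; move: P BP; apply: bernstein_ind => [|w f gf fm].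
  split=> [|a P P' BP BP']; first by rewrite /mkset mul0r; exact: Bs.1.
  by rewrite /mkset mulrDl -scalerAl; exact: Bs.2.
move: Q BQ; apply: bernstein_ind => [|w' g gg gn].
  split=> [|a P P' BP BP']; first by rewrite /mkset mulr0; exact: Bs.1.
  by rewrite /mkset mulrDr -scalerAr; exact: Bs.2.
rewrite /mkset homog_mul //; apply: bernstein_homog; first exact: admissible_mul.
move=> i mni.
have [->|f0] := eqVneq f 0.
  by rewrite /shiftp comp_poly0 mul0r coef0.
have [->|g0] := eqVneq g 0; first by rewrite mulr0 coef0.
have sf := degree_le_weight f0 fm; have sg := degree_le_weight g0 gn.
apply: nth_default; apply: leq_trans (size_polyMleq _ _) _.
rewrite size_shiftp; move: f0 g0 sf sg; rewrite -!size_poly_gt0.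
set k := size f; set k' := size g; lia.
Qed.

End Components.

(** * Symbols *)

Section Symbols.
Variables (K : numFieldType) (G : set nat) (c : nat).
Hypothesis cG : forall n, (c <= n)%N -> G n.
Local Notation D := (diffA K G).
Local Notation admissible := (@admissible K G).
Local Notation homog := (@homog K G).
Implicit Types (f g h : {poly K}) (w : int) (P Q : D).

(** An operator of degree -u has order at least u. Each residue class modulo u has
a least element j in Gamma, and j - u is not in Gamma, so an admissible f has
at least u distinct roots. *)
Lemma admissible_size (u : nat) f : admissible (- u%:Z) f -> f != 0 -> (u < size f)%N.
Proof.
move=> gf f0; case: u gf => [|u] gf; first by rewrite size_poly_gt0.
have ex i : exists k, `[< G (i + k * u.+1)%N >].
  by exists c; apply/asboolP/cG; nia.
(* r i is the least element of Gamma congruent to i. *)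
pose r i := (i + ex_minn (ex i) * u.+1)%N.
pose rs := [seq (r i)%:R : K | i <- iota 0 u.+1].
have -> : u.+1 = size rs by rewrite size_map size_iota.
apply: max_poly_roots => //.
  apply/allP => x /mapP[j + ->]; rewrite mem_iota /= => ju.
  apply/eqP/gf; rewrite /r; case: ex_minnP => k /asboolP // Gk kmin l Gl e.
  have k0 : (0 < k)%N by case: k e {Gk kmin} => // e; lia.
  have /kmin : `[< G (j + k.-1 * u.+1)%N >].
    by apply/asboolP; rewrite (_ : (_ + _)%N = l) //; nia.
  by rewrite leqNgt ltn_predL k0.
rewrite map_inj_in_uniq ?iota_uniq // => i i'; rewrite !mem_iota /= => iu iu'.
move=> /eqP; rewrite eqr_nat => /eqP /(congr1 (modn^~ u.+1)).
by rewrite /r ![(_ + _ * u.+1)%N]addnC !modnMDl !modn_small.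
Qed.

(** By admissible_size both deg f and deg f + w are nonnegative on nonzero
components, and 2 deg f + w is their sum. *)
Lemma bernstein_lt0 n P : n < 0 -> bernstein n P -> P = 0.
Proof.
move=> n0 /bernsteinP BP; apply: diffA_ext => w; rewrite component0.
apply/eqP/negPn/negP => f0; have := BP w (size (component P w)).-1.
rewrite -lead_coefE => h; suff /h /eqP : n < (size (component P w)).-1%:Z *+ 2 + w.
  by rewrite lead_coef_eq0 (negPf f0).
have gP := @component_admissible K G P w; move: f0 gP.
case: w {h} => [w|w] f0 gP; first by lia.
rewrite NegzE in f0 gP *; have := admissible_size gP f0; set k := size _; lia.
Qed.

(** The class of P in B^n / B^(n-1): the coefficient of x^p belongs to the
component of degree w = n - 2p, the only one in which order p has weight n. In
terms of t and the symbol xi of d/dt, the monomial x^p stands for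
t^(n-p) xi^p. *)
Definition symbol (n : nat) P : {poly K} :=
  \poly_(p < n.+1) (component P (n%:Z - p%:Z *+ 2))`_p.

Lemma symbol_linear n a P Q : symbol n (a *: P + Q) = a *: symbol n P + symbol n Q.
Proof.
apply/polyP => i; rewrite coefD coefZ !coef_poly.
by case: ltnP => _; rewrite ?mulr0 ?addr0 // componentD_linear coefD coefZ.
Qed.

Lemma symbol0 n : symbol n 0 = 0.
Proof. by apply/polyP => i; rewrite coef_poly component0 !coef0 if_same. Qed.

Lemma symbolB n P Q : symbol n (P - Q) = symbol n P - symbol n Q.
Proof.
by rewrite addrC -scaleN1r symbol_linear scaleN1r addrC.
Qed.

(** If p > n both sides vanish: the degree w = n - 2p is then below -p, too low
for an operator of order p. *)
Lemma symbol_homog_even (n p : nat) w f : admissible w f -> n%:Z = p%:Z *+ 2 + w ->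
  (size f <= p.+1)%N -> symbol n (homog w f) = f`_p *: 'X^p.
Proof.
move=> gf nE sf; apply/polyP => i; rewrite coef_poly coefZ coefXn component_homog //.
have -> : (n%:Z - i%:Z *+ 2 == w) = (i == p) by apply/eqP/eqP; lia.
have [->|_] := eqVneq i p; last by rewrite coef0 mulr0 if_same.
rewrite mulr1; case: ltnP => // np; apply/esym.
have [->|f0] := eqVneq f 0; first by rewrite coef0.
have w0 : w = - (p.*2 - n)%N%:Z by lia.
rewrite w0 in gf; have := admissible_size gf f0; lia.
Qed.

Lemma symbol_homog_odd (n : nat) w f : admissible w f ->
  (forall p : nat, n%:Z <> p%:Z *+ 2 + w) -> symbol n (homog w f) = 0.
Proof.
move=> gf nE; apply/polyP => i; rewrite coef_poly coef0 component_homog //.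
case: eqP => [e|_]; last by rewrite coef0 if_same.
by case: (nE i); lia.
Qed.

Lemma coef_mul_top f g p q : (size f <= p.+1)%N -> (size g <= q.+1)%N ->
  (f * g)`_(p + q) = f`_p * g`_q.
Proof.
move=> sf sg; rewrite coefM.
have lp : (p < (p + q).+1)%N by rewrite ltnS leq_addr.
rewrite (bigD1 (Ordinal lp)) //= addKn big1 ?addr0 // => i.
rewrite -val_eqE /= neq_ltn => /orP[ip|pi].
  by rewrite [g`__]nth_default ?mulr0 // (leq_trans sg) //; lia.
by rewrite nth_default ?mul0r // (leq_trans sf).
Qed.

Lemma coef_shiftp_top w f p : (size f <= p.+1)%N -> (shiftp w f)`_p = f`_p.
Proof.
rewrite leq_eqVlt => /orP[/eqP sf|]; last first.
  by rewrite ltnS => sf; rewrite !nth_default ?size_shiftp.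
have := lead_coef_shiftp w f.
by rewrite !lead_coefE size_shiftp sf.
Qed.

Lemma bernstein_homog_size (n : int) w f : f != 0 ->
  (forall i : nat, n < i%:Z *+ 2 + w -> f`_i = 0) ->
  exists p : nat, (size f <= p.+1)%N /\
    (n = p%:Z *+ 2 + w \/ n = p%:Z *+ 2 + 1 + w).
Proof.
move=> f0 fn; have sf : (0 < size f)%N by rewrite size_poly_gt0.
have := degree_le_weight f0 fn.
set k := size f in sf * => kn; exists (absz (n - w)%R)./2; lia.
Qed.

(** Checked on homogeneous operators. The shift in t^(w + w') f(theta + w') g(theta)
does not affect top coefficients, and the parities of m - w and n - w'
decide whether these top coefficients are seen by the symbols. *)
Lemma symbol_mul (m n : nat) P Q : bernstein m P -> bernstein n Q ->
  symbol (m + n) (P * Q) = symbol m P * symbol n Q.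
Proof.
move=> BP BQ; move: P BP; apply: bernstein_ind => [|w f gf fm].
  split=> [|a P P' hP hP']; rewrite /mkset; first by rewrite mul0r !symbol0 mul0r.
  by rewrite mulrDl -scalerAl !symbol_linear hP hP' mulrDl scalerAl.
move: Q BQ; apply: bernstein_ind => [|w' g gg gn].
  split=> [|a P P' hP hP']; rewrite /mkset; first by rewrite mulr0 !symbol0 mulr0.
  by rewrite mulrDr -scalerAr !symbol_linear hP hP' mulrDr scalerAr.
rewrite /mkset; have [->|f0] := eqVneq f 0; first by rewrite homog0 mul0r !symbol0 mul0r.
have [->|g0] := eqVneq g 0; first by rewrite homog0 mulr0 !symbol0 mulr0.
have gfg := admissible_mul gf gg.
have [p [sf pE]] := bernstein_homog_size f0 fm.
have [q [sg qE]] := bernstein_homog_size g0 gn.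
rewrite homog_mul //; have ssf : (size (shiftp w' f) <= p.+1)%N by rewrite size_shiftp.
have sfg : (size (shiftp w' f * g)%R <= (p + q).+1)%N.
  by apply: leq_trans (size_polyMleq _ _) _; move: ssf sg; lia.
case: pE => pE; case: qE => qE.
- rewrite (@symbol_homog_even _ (p + q)) //; last by lia.
  rewrite (symbol_homog_even gf pE sf) (symbol_homog_even gg qE sg).
  rewrite coef_mul_top // coef_shiftp_top //.
  by rewrite exprD -scalerAl -scalerAr scalerA.
- by rewrite symbol_homog_odd // ?(symbol_homog_odd gg) ?mulr0 // => p'; lia.
- by rewrite symbol_homog_odd // ?(symbol_homog_odd gf) ?mul0r // => p'; lia.
- rewrite (@symbol_homog_even _ (p + q).+1) //; [|by lia|exact: ltnW].
  rewrite nth_default // scale0r (symbol_homog_odd gf) ?mul0r // => p'; lia.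
Qed.

(** An index p > n, which the symbol does not record, would belong to a nonzero
component of degree n - 2p < -p and order p, against admissible_size. *)
Lemma symbol_eq0 (n : nat) P : bernstein n P -> symbol n P = 0 -> bernstein (n%:Z - 1) P.
Proof.
move=> /bernsteinP BP s0; apply/bernsteinP => w i ni.
have [/BP //|ni'] := ltP n%:Z (i%:Z *+ 2 + w).
have wE : w = n%:Z - i%:Z *+ 2 by lia.
have [ltin|lein] := ltnP i n.+1.
  by have /polyP/(_ i) := s0; rewrite coef_poly ltin coef0 wE.
apply/eqP/negPn/negP => fi.
have f0 : component P w != 0 by apply: contraNneq fi => ->; rewrite coef0.
have sf : (size (component P w) <= i.+1)%N.
  by apply/leq_sizeP => j ij; apply: BP; lia.
have gP := @component_admissible K G P w.
have w0 : w = - (i.*2 - n)%N%:Z by lia.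
rewrite {1}w0 in gP; have := admissible_size gP f0; move: sf; set k := size _; lia.
Qed.

(** Take d least with P in B^d: a zero symbol would put P in B^(d-1), which is 0
when d = 0. *)
Lemma nonzero_symbol P : P != 0 ->
  exists d : nat, bernstein d P /\ symbol d P != 0.
Proof.
move=> P0; have ex : exists d : nat, `[< bernstein d P >].
  by have [d BP] := bernstein_exhausts P; exists d; apply/asboolP.
case: (ex_minnP ex) => d /asboolP BP dmin; exists d; split=> //.
apply/eqP => /(symbol_eq0 BP); case: d dmin {BP} => [|d] dmin BP.
  by move: P0; rewrite (bernstein_lt0 _ BP) ?eqxx.
have /asboolP/dmin : bernstein d P.
  by move: BP; rewrite (_ : d.+1%:Z - 1 = d) //; lia.
by rewrite ltnn.
Qed.

Lemma diffA_mul_neq0 P Q : P != 0 -> Q != 0 -> P * Q != 0.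
Proof.
move=> /nonzero_symbol[m [BP sP]] /nonzero_symbol[n [BQ sQ]].
apply: contraNneq (mulf_neq0 sP sQ) => PQ0.
by rewrite -symbol_mul // PQ0 symbol0.
Qed.

Definition nat_roots (s : seq nat) : {poly K} :=
  \prod_(a <- [seq i%:R : K | i <- s]) ('X - a%:P).

Lemma nat_roots_monic s : nat_roots s \is monic.
Proof. exact: monic_prod_XsubC. Qed.

Lemma size_nat_roots s : size (nat_roots s) = (size s).+1.
Proof. by rewrite size_prod_XsubC size_map. Qed.

Lemma root_nat_roots s x : root (nat_roots s) x = (x \in [seq i%:R : K | i <- s]).
Proof. exact: root_prod_XsubC. Qed.

Lemma admissible_nat_roots w s :
  (forall j : nat, G j -> (forall i : nat, G i -> j%:Z + w <> i%:Z) -> j \in s) ->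
  admissible w (nat_roots s).
Proof.
move=> js j Gj nG; apply/eqP; rewrite -[_ == 0]/(root _ _) root_nat_roots.
by apply: map_f; exact: js.
Qed.

Lemma conductor_bound w (j : nat) : (forall i : nat, G i -> j%:Z + w <> i%:Z) ->
  j%:Z + w < c%:Z.
Proof.
move=> nG; rewrite ltNge; apply/negP => cj.
apply: (nG (absz (j%:Z + w)%R)); last by lia.
by apply: cG; lia.
Qed.

(** For u >= c the j in Gamma with j - u not in Gamma are exactly these numbers,
one for each residue class modulo u: if i < u is a gap, then i + u is at least
c and is the least element of Gamma in its class. So lower_poly u has the
smallest degree allowed by admissible_size. *)
Definition lower_root u i := if `[< G i >] then i else (i + u)%N.
Definition lower_poly (u : nat) := nat_roots [seq lower_root u i | i <- iota 0 u].

Lemma admissible_lower (u : nat) : (c <= u)%N -> admissible (- u%:Z) (lower_poly u).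
Proof.
move=> cu; apply: admissible_nat_roots => j Gj nG.
apply/mapP; have [ju|uj] := ltnP j u.
  by exists j; rewrite ?mem_iota // /lower_root; case: asboolP.
have nGj : ~ G (j - u)%N by move=> /nG; lia.
exists (j - u)%N; last by rewrite /lower_root; case: asboolP => // _; rewrite subnK.
by rewrite mem_iota; have := conductor_bound nG; lia.
Qed.

(** For n large every monomial t^(n-p) xi^p is the symbol of an operator in D. With
w = n - 2p it suffices that the roots forced by w number at most p: none if
w >= c, exactly -w <= p if w <= -c, and otherwise they are below 2c, while
p = (n - w) / 2 >= 2c. *)
Lemma admissible_monic (n p : nat) : (5 * c <= n)%N -> (p <= n)%N ->
  exists f, [/\ admissible (n%:Z - p%:Z *+ 2) f, size f = p.+1 & f`_p = 1].
Proof.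
move=> cn pn; suff [s sp gs] : exists2 s, (size s <= p)%N &
    admissible (n%:Z - p%:Z *+ 2) (nat_roots s).
  have mX : 'X^(p - size s) * nat_roots s \is monic.
    by rewrite monicMl ?monicXn // nat_roots_monic.
  have sz : size ('X^(p - size s) * nat_roots s) = p.+1.
    rewrite size_monicM ?monicXn ?monic_neq0 ?nat_roots_monic //.
    by rewrite size_nat_roots size_polyXn; lia.
  exists ('X^(p - size s) * nat_roots s); split=> //; first exact: admissible_mull.
  by move/monicP: mX; rewrite lead_coefE sz.
have [cw|wc] := leP (c%:Z) (n%:Z - p%:Z *+ 2).
  by exists [::] => //; apply: admissible_nat_roots => j _ /conductor_bound; lia.
have [wc'|cw'] := leP (n%:Z - p%:Z *+ 2) (- c%:Z).
  have wE : n%:Z - p%:Z *+ 2 = - (p.*2 - n)%N%:Z by lia.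
  exists [seq lower_root (p.*2 - n) i | i <- iota 0 (p.*2 - n)].
    by rewrite size_map size_iota; lia.
  by rewrite wE; apply: admissible_lower; lia.
exists (iota 0 (2 * c)); first by rewrite size_iota; lia.
apply: admissible_nat_roots => j _ /conductor_bound; rewrite mem_iota; lia.
Qed.

Lemma symbol_sum n (I : Type) (s : seq I) (F : I -> D) :
  symbol n (\sum_(i <- s) F i) = \sum_(i <- s) symbol n (F i).
Proof.
elim/big_rec2: _ => [|i x y _ <-]; first exact: symbol0.
by have := symbol_linear n 1 (F i) y; rewrite !scale1r.
Qed.

Lemma symbol_onto (n : nat) h : (5 * c <= n)%N -> (size h <= n.+1)%N ->
  exists2 P, bernstein n P & symbol n P = h.
Proof.
move=> cn sh; have /choice[f fP] : forall p, exists f, (p <= n)%N ->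
    [/\ admissible (n%:Z - p%:Z *+ 2) f, size f = p.+1 & f`_p = 1].
  move=> p; have [pn|_] := leqP p n; last by exists 0.
  by have [g gP] := admissible_monic cn pn; exists g.
exists (\sum_(p < n.+1) h`_p *: homog (n%:Z - p%:Z *+ 2) (f p)).
  apply: subspace_sum; first exact: bernstein_subspace.
  move=> p; apply: subspaceZ; first exact: bernstein_subspace.
  have [|gf sf _] := fP p; first by rewrite -ltnS.
  apply: bernstein_homog => // i ni; apply: nth_default; rewrite sf; lia.
have hE : \poly_(p < n.+1) h`_p = h.
  apply/polyP => i; rewrite coef_poly; case: ltnP => // ni.
  by rewrite nth_default // (leq_trans sh).
rewrite symbol_sum -[RHS]hE poly_def; apply: eq_bigr => p _.
have [|gf sf f1] := fP p; first by rewrite -ltnS.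
rewrite -[h`_p *: homog _ _]addr0 symbol_linear symbol0 addr0; congr (_ *: _).
by rewrite (@symbol_homog_even _ p) ?sf // ?f1 ?scale1r //; lia.
Qed.

(** Modulo lower terms B^(n+N) = U B^n + B^(n+N-d) P. On symbols this is the
statement that every polynomial h of degree at most n + N is u alpha + beta v,
where v is the symbol of P and u is prime to v; reducing beta modulo u
keeps both degrees under control. The choice u = (x - lam)^N with v(lam) <> 0
makes u prime to v, and N is taken large enough for u to be a symbol. *)
Lemma bernstein_step (d : nat) P : bernstein d P -> symbol d P != 0 ->
  exists N U, [/\ (0 < N)%N, bernstein N%:Z U & exists n0, forall n : nat,
    (n0 <= n)%N -> forall Q, bernstein (n + N)%N Q ->
      exists A B, bernstein n A /\ bernstein ((n + N)%N%:Z - 1) (Q - (U * A + B * P))].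
Proof.
move=> BP sP; have [lam lamP] : exists lam, (symbol d P).[lam] != 0.
  apply: contrapT => h; move/eqP: sP; apply; apply: poly_eq0_nat => i.
  by apply/eqP/negPn/negP => ni; apply: h; exists i%:R.
pose N := (5 * c).+1; pose u : {poly K} := ('X - lam%:P) ^+ N.
have mu : u \is monic by rewrite monic_exp // monicXsubC.
have su : size u = N.+1 by rewrite size_exp_XsubC.
have [U BU sU] : exists2 U : D, bernstein N U & symbol N U = u.
  by apply: symbol_onto; rewrite ?su // /N leqnSn.
exists N, U; split=> //; exists (5 * c + d)%N => n n0 Q BQ.
have cop : coprimep u (symbol d P).
  by rewrite coprimep_expl // coprimep_sym coprimep_XsubC.
have /Bezout_eq1_coprimepP[[a b] /= ab1] := cop.
pose h := symbol (n + N) Q; pose beta := (h * b) %% u.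
pose alpha := (h - beta * symbol d P) %/ u.
have sbeta : (size beta <= N)%N.
  by rewrite -ltnS -su ltn_modp monic_neq0.
have hE : h = u * alpha + beta * symbol d P.
  have dv : u %| h - beta * symbol d P.
    have -> : h - beta * symbol d P =
        (h * a + (h * b) %/ u * symbol d P) * u.
      have -> : beta = h * b - (h * b) %/ u * u.
        by rewrite {1}(divp_eq (h * b) u) addrC addrA addNr add0r.
      by rewrite -{1}[h]mulr1 -ab1; ring.
    by rewrite dvdp_mull.
  by rewrite mulrC divpK // subrK.
have sh : (size h <= (n + N).+1)%N by exact: size_poly.
have sa : (size alpha <= n.+1)%N.
  rewrite size_divp ?monic_neq0 // su leq_subLR addSn /= .
  apply: leq_trans (size_polyD _ _) _; rewrite size_polyN geq_max.
  apply/andP; split; first by move: sh; lia.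
  apply: leq_trans (size_polyMleq _ _) _.
  have : (size (symbol d P) <= d.+1)%N by exact: size_poly.
  by move: sbeta; set kb := size beta; set ks := size (symbol d P); rewrite /N; lia.
have [A BA sA] := symbol_onto (leq_trans (leq_addr _ _) n0) sa.
have [||B BB sB] := @symbol_onto (n + N - d) beta; first by lia.
  by apply: leq_trans sbeta _; lia.
exists A, B; split=> //.
have nNd : (n + N = (n + N - d) + d)%N by lia.
have Bs := @bernstein_subspace K G.
apply: symbol_eq0.
  apply: subspaceB => //; apply: subspaceD => //.
    by rewrite addnC PoszD; exact: bernstein_mul.
  by rewrite nNd PoszD; exact: bernstein_mul.
rewrite symbolB -/h hE -[U * A]scale1r symbol_linear scale1r.
rewrite {1}[(n + N)%N]addnC symbol_mul // sU sA nNd symbol_mul // sB.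
by rewrite subrr.
Qed.

End Symbols.

(** * Restriction of scalars to k *)

Section Restriction.
Variables (K : fieldType) (G : set nat).
Local Notation D := (diffA K G).

Lemma alg_central (a : K) (P : D) : P * a%:A = a%:A * P.
Proof. by rewrite mulr_algr mulr_algl. Qed.

(** An alias of M carrying its structure of k-vector space, so that the results on
subspaces apply to D-modules. *)
Definition restrict (M : lmodType D) : Type := M.

Section Scale.
Variable M : lmodType D.
HB.instance Definition _ := GRing.Zmodule.on (restrict M).

Let rscale (a : K) (x : restrict M) : restrict M := (a%:A : D) *: (x : M).

Fact rscaleA a b x : rscale a (rscale b x) = rscale (a * b) x.
Proof. by rewrite /rscale scalerA mulr_algl scalerA. Qed.
Fact rscale1 : left_id 1 rscale.
Proof. by move=> x; rewrite /rscale !scale1r. Qed.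
Fact rscaleDr : right_distributive rscale +%R.
Proof. by move=> a x y; rewrite /rscale scalerDr. Qed.
Fact rscaleDl x : {morph rscale^~ x : a b / a + b}.
Proof. by move=> a b; rewrite /rscale !scalerDl. Qed.

HB.instance Definition _ := GRing.Zmodule_isLmodule.Build K (restrict M)
  rscaleA rscale1 rscaleDr rscaleDl.

Definition act (P : D) : restrict M -> restrict M := fun x => P *: (x : M).

Lemma act_linear P a x y : act P (a *: x + y) = a *: act P x + act P y.
Proof.
rewrite /act (scalerDr P) /=; congr (_ + _).
by rewrite [RHS]scalerA -alg_central -scalerA.
Qed.

Lemma actM P Q x : act (P * Q) x = act P (act Q x).
Proof. by rewrite /act scalerA. Qed.

Lemma act_scale a P x : act (a *: P) x = a *: act P x.
Proof. by rewrite /act -mulr_algl -scalerA. Qed.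

Lemma actD P Q x : act (P + Q) x = act P x + act Q x.
Proof. by rewrite /act scalerDl. Qed.

Lemma act1 x : act 1 x = x.
Proof. by rewrite /act scale1r. Qed.

Lemma submodule_subspace (N : set M) :
  submodule N -> subspace (N : set (restrict M)).
Proof. by move=> [N0 ND]; split=> // a x y; exact: ND. Qed.

Lemma submodule_act (N : set M) P x : submodule N -> N x -> N (act P x).
Proof. by move=> [N0 ND] Nx; rewrite -[act P x]addr0; exact: ND. Qed.

Lemma submodule_cyclic_mod (N : set M) y : submodule N ->
  submodule [set x | exists Q : D, N (x - Q *: y)].
Proof.
move=> sN; split; first by exists 0; rewrite scale0r subr0; exact: sN.1.
move=> a x z [Q Nx] [Q' Nz]; exists (a * Q + Q').
by rewrite scalerDl -scalerA opprD addrACA -scalerBr; exact: sN.2.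
Qed.

End Scale.
End Restriction.

(** * Simplicity, faithfulness and linear growth *)

Section Faithful.
Variables (K : numClosedFieldType) (G : set nat) (c : nat).
Hypothesis cG : forall n, (c <= n)%N -> G n.
Local Notation D := (diffA K G).
Local Notation admissible := (@admissible K G).
Local Notation homog := (@homog K G).
Variable M : lmodType D.
Implicit Types (f g : {poly K}) (P Q : D) (N W : set M).

Local Notation s := c.+1.
Local Notation q := (lower_poly K G s).

(** Raising and lowering by s are the operators X = t^s and Y = t^-s q(theta); the
residue classes modulo s keep the roots of q apart. *)
Definition raising : D := homog s%:Z 1.
Definition lowering : D := homog (- s%:Z) q.
Definition euler f : D := homog 0 f.

Lemma admissible_raising : admissible s%:Z 1.
Proof. by move=> j Gj /(conductor_bound cG); lia. Qed.

Lemma admissible_lowering : admissible (- s%:Z) q.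
Proof. by apply: (admissible_lower K cG); exact: leqnSn. Qed.

Lemma shiftp0 f : shiftp 0 f = f.
Proof. by rewrite /shiftp addr0 comp_polyXr. Qed.

Lemma eulerM f g : euler (f * g) = euler f * euler g.
Proof. by rewrite /euler homog_mul ?shiftp0; [|exact: admissible0..]. Qed.

Lemma euler_linear a f g : euler (a *: f + g) = a *: euler f + euler g.
Proof. by apply: homog_linear; exact: admissible0. Qed.

Lemma euler1 : euler 1 = 1.
Proof.
apply: diffA_ext => w; rewrite component_homog; last exact: admissible0.
apply/esym/component_eq => j; rewrite [LHS](lcoef_mon K j) -{2}[j]addr0 (inj_eq (addrI j)).
by case: eqP; rewrite ?hornerC ?horner0.
Qed.

Lemma bernstein1 : bernstein 0 (1 : D).
Proof.
apply/bernsteinP => w i wi; rewrite -euler1 component_homog; last exact: admissible0.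
by case: eqP wi => [->|_ _]; rewrite ?coef0 // coef1; case: i.
Qed.

Lemma lowering_euler_raising f :
  lowering * euler f * raising = euler (shiftp s (q * f)).
Proof.
have g0 := @admissible0 K G f; have gq := admissible_lowering; have g1 := admissible_raising.
rewrite /lowering /euler /raising homog_mul // homog_mul //; last exact: admissible_mul.
by rewrite addr0 addNr shiftp0 mulr1.
Qed.

Lemma raising_euler_lowering f :
  raising * euler f * lowering = euler (shiftp (- s%:Z) f * q).
Proof.
have g0 := @admissible0 K G f; have gq := admissible_lowering; have g1 := admissible_raising.
rewrite /lowering /euler /raising homog_mul // homog_mul //; last exact: admissible_mul.
by rewrite addr0 subrr shiftp0 mul1r.
Qed.

Lemma last_root f a d : f != 0 -> d != 0 -> root f a ->
  exists k : nat, root f (a + d *+ k) /\ ~~ root f (a + d *+ k.+1).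
Proof.
move=> f0 d0 fa; apply: contrapT => h.
have all_roots k : root f (a + d *+ k).
  elim: k => [|k IH]; first by rewrite addr0.
  by apply/negPn/negP => nk; apply: h; exists k.
pose rs := [seq a + d *+ i | i <- iota 0 (size f)].
have : (size rs < size f)%N.
  apply: max_poly_roots => //; first by apply/allP => x /mapP[i _ ->].
  rewrite map_inj_uniq ?iota_uniq // => i j /addrI /eqP.
  by rewrite -subr_eq0 -(mulr_natr d i) -(mulr_natr d j) -mulrBr mulf_eq0
    (negPf d0) /= subr_eq0 eqr_nat => /eqP.
by rewrite size_map size_iota ltnn.
Qed.

(** lower_root s i is congruent to i, and i runs over 0, ..., s - 1. *)
Lemma lowering_roots_incongruent a m : root q a -> root q (a + (s * m)%:R) ->
  m = 0%N.
Proof.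
have lr i : (lower_root G s i = i %[mod s])%N.
  by rewrite /lower_root; case: asboolP => // _; rewrite modnDr.
rewrite !root_nat_roots => /mapP[x xs ->] /mapP[y ys].
have [j + ->] := mapP xs; have [k + ->] := mapP ys.
rewrite !mem_iota => /= ltks ltjs.
move=> /eqP; rewrite -natrD eqr_nat => /eqP e.
have : (lower_root G s j = lower_root G s k %[mod s])%N.
  by rewrite -e addnC mulnC modnMDl.
rewrite !lr !modn_small // => ij; move: e; rewrite ij; nia.
Qed.

(** J is a nonzero ideal of k[x], generated by an element f of least degree. If f
were not constant it would have a root a, common to all of J. Multiplication by X
and Y on the two sides, in the forms Y J X <= J and X J Y <= J, says that where the common
roots in a + s Z stop, q vanishes: at the first non-root above a and at the last
root below a. These two roots of q are congruent modulo s and distinct. *)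
Lemma euler_torsion N W f : submodule N ->
  (forall x, W x -> W (raising *: x)) -> (forall x, W x -> W (lowering *: x)) ->
  f != 0 -> (forall x, W x -> N (euler f *: x)) -> W `<=` N.
Proof.
move=> sN Wr Wl.
pose J := [set g | forall x, W x -> N (euler g *: x)].
have JD a g h : J g -> J h -> J (a *: g + h).
  move=> Jg Jh x Wx; rewrite euler_linear scalerDl -mulr_algl -scalerA.
  by apply: sN.2; [exact: Jg|exact: Jh].
have JM g h : J h -> J (g * h).
  by move=> Jh x Wx; rewrite eulerM -scalerA; apply: submodule_act => //; exact: Jh.
move: f => f0 f0n Jf0.
have ex : exists k, `[< exists f, [/\ f != 0, size f = k & J f] >].
  by exists (size f0); apply/asboolP; exists f0.
case: (ex_minnP ex) => k /asboolP[f [fn0 sf Jf]] kmin.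
have Jdvd g : J g -> f %| g.
  move=> Jg; apply/negPn/negP; rewrite /dvdp => r0.
  have : (k <= size (g %% f)%R)%N.
    apply: kmin; apply/asboolP; exists (g %% f); split=> //.
    have -> : g %% f = -1 *: ((g %/ f) * f) + g.
      by rewrite {3}(divp_eq g f) scaleN1r addrA addNr add0r.
    by apply: JD => //; exact: JM.
  by rewrite leqNgt -sf ltn_modp fn0.
have Jup g : J g -> J (shiftp s (q * g)).
  move=> Jg x Wx; rewrite -lowering_euler_raising -!scalerA.
  by apply: (submodule_act lowering sN); apply: Jg; exact: Wr.
have Jdown g : J g -> J (shiftp (- s%:Z) g * q).
  move=> Jg x Wx; rewrite -raising_euler_lowering -!scalerA.
  by apply: (submodule_act raising sN); apply: Jg; exact: Wl.
have Jroot g x : J g -> root f x -> root g x.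
  by move=> /Jdvd/dvdpP[h ->] fx; rewrite rootM fx orbT.
have [s1|s1] := eqVneq (size f) 1%N.
  move=> x Wx; have /eqP/size_poly1P[a a0 fE] := s1.
  rewrite -[x]scale1r -euler1; suff : J 1 by apply.
  by rewrite -polyC1 -(mulVf a0) polyCM -fE; exact: JM.
have /closed_rootP[a fa] := s1.
have s0 : s%:R != 0 :> K by rewrite pnatr_eq0.
have [i [fi fi1]] := last_root fn0 s0 fa.
have ns0 : - s%:R != 0 :> K by rewrite oppr_eq0.
have [j [fj fj1]] := last_root fn0 ns0 fa.
have qi : root q (a + s%:R *+ i.+1).
  have := Jroot _ _ (Jup _ Jf) fi.
  rewrite /root horner_shiftp -addrA -mulrSr hornerM mulf_eq0.
  by move: fi1; rewrite /root => /negPf ->; rewrite orbF.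
have qj : root q (a + (- s%:R) *+ j).
  have := Jroot _ _ (Jdown _ Jf) fj.
  rewrite rootM /root horner_shiftp mulrNz -addrA -mulrSr.
  by move: fj1; rewrite /root => /negPf ->.
have := lowering_roots_incongruent (m := i.+1 + j) qj.
suff -> : a + - s%:R *+ j + (s * (i.+1 + j))%:R = a + s%:R *+ i.+1.
  by move=> /(_ qi).
by rewrite natrM natrD mulrDr mulNrn !mulr_natr addrACA addNr addr0.
Qed.

(** The commutator with theta, which acts on degree w as multiplication by w; it
serves to isolate homogeneous components. *)
Definition ad P : D := euler 'X * P - P * euler 'X.

Lemma ad_linear a P Q : ad (a *: P + Q) = a *: ad P + ad Q.
Proof.
by rewrite /ad mulrDr mulrDl -scalerAr -scalerAl opprD addrACA -scalerBr.
Qed.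

Lemma ad_homog w f : admissible w f -> ad (homog w f) = w%:~R *: homog w f.
Proof.
move=> gf; have g0 := @admissible0 K G 'X; rewrite /ad /euler !homog_mul // add0r addr0.
apply: diffA_ext => w'.
have gX := @admissible_mull K G w 'X f gf.
have gX' := @admissible_mull K G w (shiftp w 'X) f gf.
have gX2 : admissible w (shiftp 0 f * 'X) by rewrite shiftp0 mulrC.
rewrite addrC -scaleN1r componentD_linear !component_homog //.
rewrite -[w%:~R *: _]addr0 componentD_linear component0 component_homog // addr0.
case: eqP => _; last by rewrite !scaler0 addr0.
rewrite shiftp0 scaleN1r /shiftp comp_polyX mulrDl mulrC addrA addNr add0r.
by rewrite mul_polyC.
Qed.

Lemma component_ad w P : component (ad P) w = w%:~R *: component P w.
Proof.
have [r _ ->] := diffA_decomp P.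
move: (component P) (@component_admissible _ _ P) => p gp; elim: r => [|w' r IH].
  rewrite big_nil; have -> : ad 0 = 0 by rewrite /ad mulr0 mul0r subrr.
  by rewrite component0 scaler0.
rewrite big_cons -[homog w' _]scale1r ad_linear !componentD_linear IH ad_homog //.
rewrite -[w'%:~R *: _]addr0 componentD_linear component0 component_homog // addr0 !scale1r.
by case: eqP => [->|_]; rewrite scalerDr ?scaler0.
Qed.

(** Either ad P = w P and P is homogeneous, or ad P - w P is a nonzero element of I
with fewer components. *)
Lemma homogeneous_component (I : set D) P : subspace I ->
  (forall Q, I Q -> I (ad Q)) -> I P -> P != 0 ->
  exists w f, [/\ admissible w f, f != 0 & I (homog w f)].
Proof.
move=> sI Iad; have [r _] := diffA_decomp P.
move: (component P) (@component_admissible _ _ P) => p gp.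
elim: r P p gp => [|w r IH] P p gp PE IP P0.
  by move: P0; rewrite PE big_nil eqxx.
(* Q loses the component of degree w and multiplies the others by w' - w. *)
pose Q := ad P - w%:~R *: P.
have IQ : I Q by apply: subspaceB => //; [exact: Iad|exact: subspaceZ].
have componentQ w' : component Q w' = (w' - w)%:~R *: component P w'.
  rewrite /Q addrC -scaleNr componentD_linear component_ad -scalerDl intrB.
  by rewrite addrC.
have [Q0|Q0] := eqVneq Q 0.
  have componentP w' : w' != w -> component P w' = 0.
    move=> ww; have := componentQ w'; rewrite Q0 component0 => /esym/eqP.
    by rewrite scaler_eq0 intr_eq0 subr_eq0 (negPf ww) => /eqP.
  have PE' : P = homog w (component P w).
    apply: diffA_ext => w'; rewrite component_homog; last exact: component_admissible.
    by case: eqP => [->|/eqP/componentP].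
  exists w, (component P w); split; [exact: component_admissible| |by rewrite -PE'].
  by apply: contraNneq P0 => f0; rewrite PE' f0 homog0.
apply: (IH Q (fun w' => (w' - w)%:~R *: p w')) => //.
  move=> w'; rewrite -[_ *: _]addr0; apply: admissible_linear => // j _ _.
  by rewrite horner0.
apply: diffA_ext => w'; rewrite componentQ PE component_sum component_sum big_cons.
rewrite component_homog //.
have -> : (w' - w)%:~R *: ((if w' == w then p w else 0) +
    \sum_(j <- r) component (homog j (p j)) w') =
    (w' - w)%:~R *: \sum_(j <- r) component (homog j (p j)) w'.
  by case: eqP => [->|_]; rewrite ?subrr ?scale0r ?add0r.
rewrite scaler_sumr; apply: eq_bigr => j _; rewrite !component_homog //.
  by case: eqP => [->|]; rewrite ?scaler0.
move=> j' Gj' nG; rewrite hornerZ gp ?mulr0 //.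
Qed.

(** The operators that send D v into N form a two-sided ideal. If it were nonzero it
would contain some t^w f(theta), hence, after a left multiplication that brings
the degree to 0, a nonzero polynomial in theta, against euler_torsion for
W = D v. *)
Lemma faithful N P v : submodule N -> P != 0 -> ~ N v ->
  exists Q, ~ N (P *: (Q *: v)).
Proof.
move=> sN P0 nNv; apply: contrapT => h.
pose I := [set P | forall Q, N (P *: (Q *: v))].
have sI : subspace I.
  split=> [Q|a Q Q' IQ IQ' R]; first by rewrite scale0r; exact: sN.1.
  rewrite scalerDl -mulr_algl -(scalerA a%:A).
  by apply: sN.2; [exact: IQ|exact: IQ'].
have Il Q Q' : I Q -> I (Q' * Q).
  by move=> IQ R; rewrite -scalerA; apply: (submodule_act Q' sN); exact: IQ.
have Ir Q Q' : I Q -> I (Q * Q').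
  by move=> IQ R; rewrite -scalerA [Q' *: _]scalerA; exact: IQ.
have IP : I P by move=> Q; apply: contrapT => nQ; apply: h; exists Q.
have [|w [f [gf f0 If]]] := homogeneous_component sI _ IP P0.
  by move=> Q IQ; apply: (subspaceB sI); [exact: Il|exact: Ir].
(* Every j in Gamma with j - w outside Gamma is below c + w. *)
pose g := nat_roots K (iota 0 (c + absz w)).
have gg : admissible (- w) g.
  by apply: admissible_nat_roots => j Gj /(conductor_bound cG); rewrite mem_iota; lia.
have := Il _ (homog (- w) g) If; rewrite homog_mul // addNr => Ie.
pose W := [set x | exists Q, x = Q *: v].
apply/nNv/(@euler_torsion N W (shiftp w g * f)) => //.
- by move=> _ [Q ->]; exists (raising * Q); rewrite scalerA.
- by move=> _ [Q ->]; exists (lowering * Q); rewrite scalerA.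
- rewrite mulf_neq0 // shiftp_eq0 monic_neq0 //.
  exact: nat_roots_monic.
- by move=> _ [Q ->]; exact: Ie.
- by exists 1; rewrite scale1r.
Qed.

(** If theta acts on the u i, modulo N, through the matrix A, then f(theta) acts
through f(A). *)
Lemma euler_cayley N k (A : 'M[K]_k.+1) (u : nat -> restrict M) : submodule N ->
  (forall i : 'I_k.+1, N (act (euler 'X) (u i) - \sum_(j < k.+1) A i j *: u j)) ->
  forall f (i : 'I_k.+1),
    N (act (euler f) (u i) - \sum_(j < k.+1) horner_mx A f i j *: u j).
Proof.
move=> sN NA; have sN' := submodule_subspace sN.
elim/poly_ind => [|f a IH] i.
  rewrite rmorph0 big1 => [|j _]; last by rewrite mxE scale0r.
  rewrite /euler homog0 /act scale0r subr0; exact: sN.1.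
have -> : f * 'X + a%:P = a *: 1 + 'X * f by rewrite alg_polyC mulrC addrC.
rewrite euler_linear actD act_scale euler1 act1 eulerM actM.
have -> : horner_mx A (a *: 1 + 'X * f) = a%:M + horner_mx A f *m A.
  by rewrite mulrC rmorphD rmorphM /= horner_mx_X linearZ /= rmorph1 scalemx1.
have -> : \sum_(j < k.+1) (a%:M + horner_mx A f *m A) i j *: u j =
    a *: u i + \sum_(l < k.+1) horner_mx A f i l *: \sum_(j < k.+1) A l j *: u j.
  under eq_bigr => j _ do rewrite mxE scalerDl.
  rewrite big_split /=; congr (_ + _).
    rewrite (bigD1 i) //= mxE eqxx mulr1n big1 ?addr0 // => j ji.
    by rewrite mxE eq_sym (negPf ji) mulr0n scale0r.
  under [RHS]eq_bigr => l _ do rewrite scaler_sumr.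
  rewrite exchange_big /=; apply: eq_bigr => j _.
  by rewrite mxE scaler_suml; apply: eq_bigr => l _; rewrite scalerA.
rewrite opprD addrACA subrr add0r.
set S := \sum_(l < _) _.
have -> : act (euler 'X) (act (euler f) (u i)) =
    act (euler 'X) (act (euler f) (u i) - \sum_(j < k.+1) horner_mx A f i j *: u j)
    + act (euler 'X) (\sum_(j < k.+1) horner_mx A f i j *: u j).
  by have := act_linear (euler 'X) 1 (act (euler f) (u i) -
    \sum_(j < k.+1) horner_mx A f i j *: u j)
    (\sum_(j < k.+1) horner_mx A f i j *: u j); rewrite !scale1r subrK.
rewrite -addrA; apply: (subspaceD sN'); first exact: submodule_act.
have -> : act (euler 'X) (\sum_(j < k.+1) horner_mx A f i j *: u j) =
    \sum_(j < k.+1) horner_mx A f i j *: act (euler 'X) (u j).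
  elim/big_rec2: _ => [|l x y _ <-]; last by rewrite act_linear.
  by rewrite /act scaler0.
rewrite -sumrB; apply: subspace_sum => // l; rewrite -scalerBr.
by apply: subspaceZ.
Qed.

Definition growth_rate (n1 : nat) : Prop :=
  forall N v, submodule N -> ~ N v -> forall k, exists u : nat -> restrict M,
    (forall i, (i < k)%N -> exists2 P, bernstein (k * n1)%N P & u i = P *: v) /\
    indep (N : set (restrict M)) k u.

(** A family in B^(k n1) v, independent modulo N, can always be extended inside
B^((k+1) n1) v. Otherwise W = N + span(u) contains B^((k+1) n1) v, so it is
stable under X, Y and theta, which lie in B^n1. The matrix of theta on W / N
is annihilated by its characteristic polynomial, and euler_torsion gives W = N,
though v is in W. The rate n1 depends on neither M nor N. *)
Lemma growth : exists2 n1 : nat, (0 < n1)%N & growth_rate n1.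
Proof.
have [nr Br] := bernstein_exhausts raising.
have [nl Bl] := bernstein_exhausts lowering.
have [ne Be] := bernstein_exhausts (euler 'X).
pose n1 := (nr + nl + ne).+1; exists n1 => // N v sN nNv.
have sN' := submodule_subspace sN.
elim=> [|k [u [uB iu]]]; first by exists (fun=> 0); split.
have st (n : nat) P : (n <= n1)%N -> bernstein n P -> bernstein n1 P.
  by move=> nn; apply: bernstein_le.
pose W := span_mod (N : set (restrict M)) k u.
have sW : subspace W by exact: span_mod_subspace.
have NW : (N : set (restrict M)) `<=` W by exact: span_mod_base.
have [P BP nWP] : exists2 P : D, bernstein (k.+1 * n1)%N P & ~ W (P *: v).
  apply: contrapT => h.
  have BW P : bernstein (k.+1 * n1)%N P -> W (P *: v).
    by move=> BP; apply: contrapT => nW; apply: h; exists P.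
  have Wst P : bernstein n1 P -> forall x, W x -> W (act P x).
    move=> BP; apply: span_mod_min.
    - split=> [|a x y Wx Wy]; first by rewrite /mkset /act scaler0; exact: sW.1.
      by rewrite /mkset act_linear; exact: sW.2.
    - by move=> x Nx; apply: NW; exact: submodule_act.
    - move=> i ik; have [Q BQ ->] := uB i ik.
      rewrite /mkset -actM; apply: BW.
      by rewrite mulSn PoszD; exact: bernstein_mul.
  have Wv : W v by rewrite -[v]scale1r; apply: BW; apply: bernstein_le bernstein1.
  (* An empty family would give W = N; otherwise theta has a matrix of positive size. *)
  case: k u {iu} uB @W sW NW h BW Wst Wv => [|k] u uB W sW NW _ BW Wst Wv.
    by case: Wv => a; rewrite /lcomb big_ord0 subr0.
  have Wu := @span_mod_family _ _ _ k.+1 u sN'.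
  have Be' : bernstein n1 (euler 'X) by apply: st Be; rewrite /n1; lia.
  have /choice[A NA] : forall i : 'I_k.+1, exists a : nat -> K,
      N (act (euler 'X) (u i) - lcomb k.+1 a u).
    by move=> i; apply: (Wst _ Be'); exact: Wu.
  pose B : 'M[K]_k.+1 := \matrix_(i, j) A i j.
  have NB : forall i : 'I_k.+1,
      N (act (euler 'X) (u i) - \sum_(j < k.+1) B i j *: u j).
    move=> i; have := NA i; congr (N (_ - _)).
    by apply: eq_bigr => j _; rewrite mxE.
  have CH := euler_cayley sN NB (char_poly B).
  have f0 : char_poly B != 0 by rewrite monic_neq0 // char_poly_monic.
  have Br' : bernstein n1 raising by apply: st Br; rewrite /n1; lia.
  have Bl' : bernstein n1 lowering by apply: st Bl; rewrite /n1; lia.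
  apply/nNv/(euler_torsion sN (Wst _ Br') (Wst _ Bl') f0) => //.
  apply: (@span_mod_min _ (restrict M) N k.+1 u
    [set x | N (act (euler (char_poly B)) x)]).
  - split=> [|a x y Wx Wy]; first by rewrite /mkset /act scaler0; exact: sN.1.
    by rewrite /mkset act_linear; exact: sN'.2.
  - by move=> x Nx; exact: submodule_act.
  - move=> i ik; have := CH (Ordinal ik); rewrite Cayley_Hamilton.
    by rewrite big1 ?subr0 // => j _; rewrite mxE scale0r.
exists (cat_family k u (fun=> P *: v)); split.
  move=> i; rewrite ltnS leq_eqVlt /cat_family => /orP[/eqP ->|ik].
    by rewrite ltnn; exists P.
  rewrite ik; have [Q BQ ->] := uB i ik; exists Q => //.
  by apply: bernstein_le BQ; rewrite lez_nat leq_mul2r leqnSn orbT.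
rewrite -addn1; apply: (@indep_cat _ _ _ W) => //; last exact: indep1.
exact: span_mod_family.
Qed.

End Faithful.

(** * Comparison of the two notions of dimension *)

Section Kdim.
Variables (K : fieldType) (G : set nat) (M : lmodType (diffA K G)).
Local Notation rM := (restrict M).

Definition extend_family (T : Type) (x0 : T) d (u : 'I_d -> T) : nat -> T :=
  fun n => if insub n is Some k then u k else x0.

Lemma extend_familyE (T : Type) (x0 : T) d (u : 'I_d -> T) (k : 'I_d) :
  extend_family x0 u k = u k.
Proof. by rewrite /extend_family valK. Qed.

Lemma kdim_of_has_dim (U : set rM) d : has_dim U d -> kdim (U : set M) d.
Proof.
move=> [u [Uu iu Us]]; exists (fun k : 'I_d => u k); split=> [k|x Ux].
  exact: Uu.
have [b xb] := Us x Ux; exists [ffun k => b (val k)]; split.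
  have -> : x = lcomb d b u by apply/eqP; rewrite -subr_eq0; apply/eqP.
  by apply: eq_bigr => k _; rewrite ffunE.
move=> b' xb'; apply/ffunP => k; rewrite ffunE; apply/eqP.
rewrite -subr_eq0; apply/eqP.
pose a n := b n - extend_family 0 b' n.
suff /iu/(_ k (ltn_ord k)) : [set 0] (lcomb d a u) by rewrite /a extend_familyE.
have -> : lcomb d a u = lcomb d b u - x.
  rewrite [X in _ - X]xb' /lcomb -sumrB; apply: eq_bigr => k' _.
  by rewrite /a scalerBl extend_familyE.
by rewrite -opprB -oppr0; congr (- _).
Qed.

Lemma indep_le_kdim (U : set rM) d r u : kdim (U : set M) d ->
  family_in U r u -> indep [set 0] r u -> (r <= d)%N.
Proof.
move=> [v [_ Us]] Uu.
apply: (@indep_le_span _ rM [set 0] _ _ _ (extend_family 0 (v : 'I_d -> rM))).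
  exact: subspace0.
move=> k kr; have [b [ub _]] := Us _ (Uu k kr).
exists (extend_family 0 b); apply/eqP; rewrite subr_eq0; apply/eqP.
rewrite [LHS]ub; apply: eq_bigr => n _.
by rewrite !extend_familyE.
Qed.

End Kdim.

(** * Modules of finite length are cyclic and not free *)

Section Main.
Variables (K : numClosedFieldType) (G : set nat) (c : nat).
Hypothesis cG : forall n, (c <= n)%N -> G n.
Local Notation D := (diffA K G).
Variable M : lmodType D.
Local Notation rM := (restrict M).

Lemma raising_neq0 : raising K G c != 0.
Proof.
apply/eqP => /(congr1 (fun P : D => component P c.+1)).
rewrite component0 component_homog; last exact: (admissible_raising K cG).
by rewrite eqxx; apply/eqP; rewrite oner_eq0.
Qed.

(** The symbol of P X is nonzero in positive weight, while 1 has weight 0. *)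
Lemma raising_no_left_inverse P : P * raising K G c != 1.
Proof.
have gr := admissible_raising K cG.
have [->|P0] := eqVneq P 0; first by rewrite mul0r eq_sym oner_eq0.
have [d [BP sP]] := nonzero_symbol cG P0.
have Br : bernstein c.+1 (raising K G c).
  apply: bernstein_homog => // k; rewrite coef1.
  by case: eqP => [->|//] h; exfalso; lia.
have sr : symbol c.+1 (raising K G c) = 1.
  have e : c.+1%:Z = 0%N%:Z *+ 2 + c.+1%:Z by lia.
  by rewrite (symbol_homog_even cG gr e) ?size_poly1 // coef1 scale1r.
apply/eqP => Pr; have := symbol_mul cG BP Br; rewrite Pr sr mulr1.
suff -> : symbol (d + c.+1) (1 : D) = 0 by move=> s0; rewrite -s0 eqxx in sP.
apply/polyP => k; rewrite coef0 coef_poly -euler1 component_homog; last exact: admissible0.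
case: ltnP => // _; case: eqP => [e|_]; last by rewrite coef0.
by rewrite coef1; case: k e => // e; lia.
Qed.

(** The submodule N + D X x is N or N'. In the first case X x is in N; in the second
x = Q X x modulo N for some Q, and 1 - Q X is not zero. *)
Lemma torsion_step (N N' : set M) x : submodule N -> submodule N' ->
  simple_step N N' -> N' x -> exists2 P : D, P != 0 & N (P *: x).
Proof.
move=> sN sN' [[NN' _] min] N'x; pose X := raising K G c.
have [NX|nNX] := pselect (N (X *: x)).
  by exists X => //; exact: raising_neq0.
pose L := [set y | exists Q : D, N (y - Q *: (X *: x))].
have sL : submodule L by exact: submodule_cyclic_mod.
have NL : N `<=` L by move=> y Ny; exists 0; rewrite scale0r subr0.
have LN' : L `<=` N'.
  move=> y [Q Ny]; rewrite -[y](subrK (Q *: (X *: x))).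
  rewrite -[_ - _]scale1r; apply: sN'.2; first exact: NN'.
  by apply: (submodule_act Q sN'); exact: (submodule_act X sN').
have LX : L (X *: x) by exists 1; rewrite scale1r subrr; exact: sN.1.
case: (min L sL NL LN') => LE; first by rewrite LE in LX.
have : L x by rewrite LE.
move=> [Q NQ]; exists (1 - Q * X); last by rewrite scalerBl scale1r -scalerA.
by rewrite subr_eq0 eq_sym; exact: raising_no_left_inverse.
Qed.

Lemma finite_length_torsion : finite_length M ->
  forall x : M, exists2 P : D, P != 0 & P *: x = 0.
Proof.
move=> [l [N [N0 Nl sN stepN]]].
suff h : forall k, (k <= l)%N -> forall x, N k x ->
    exists2 P : D, P != 0 & P *: x = 0.
  by move=> x; apply: (h l) => //; rewrite Nl.
elim=> [_ x|k IH kl x Nx].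
  by rewrite N0 => ->; exists 1; rewrite ?oner_eq0 ?scaler0.
have [Q Q0 NQ] := torsion_step (sN k (ltnW kl)) (sN _ kl) (stepN k kl) Nx.
have [P P0 PQ] := IH (ltnW kl) _ NQ.
by exists (P * Q); [exact: (diffA_mul_neq0 cG)|rewrite -scalerA].
Qed.

(** Descends a composition series, from a generator g modulo N_(j+1) to a generator
g + w modulo N_j. As g is torsion there is P <> 0 with P g = 0, and as
N_(j+1) / N_j is faithful there is w in N_(j+1) with P w outside N_j. Then
P (g + w) = P w is a nonzero element of the simple module N_(j+1) / N_j, so
D (g + w) contains that module, hence w, hence g. *)
Lemma finite_length_cyclic : finite_length M -> cyclic M.
Proof.
move=> fl; have tors := finite_length_torsion fl.
move: fl => [l [N [N0 Nl sN stepN]]].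
suff h : forall k, (k <= l)%N ->
    exists g : M, forall x, exists a : D, N (l - k)%N (x - a *: g).
  have [g gen] := h l (leqnn l); exists g => x; have [a] := gen x.
  by rewrite subnn N0 => /eqP; rewrite subr_eq0 => /eqP; exists a.
elim=> [_|k IH kl].
  by exists 0 => x; exists 0; rewrite subn0 Nl.
have [g gen] := IH (ltnW kl).
have ltl : (l - k.+1 < l)%N by lia.
have E : (l - k = (l - k.+1).+1)%N by lia.
set j := (l - k.+1)%N in ltl E *; rewrite E in gen.
have [sj sj1] := (sN j (ltnW ltl), sN j.+1 ltl).
have [[NN /nonsubset[v [Nv nNv]]] min] := stepN j ltl.
have [P P0 Pg] := tors g.
have [Q nNQ] := faithful cG sj P0 nNv.
set w := Q *: v in nNQ.
have Nw : N j.+1 w by exact: (submodule_act Q sj1).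
exists (g + w).
pose L := [set y | exists a : D, N j (y - a *: (g + w))].
have sL : submodule L by exact: submodule_cyclic_mod.
have NL : N j `<=` L by move=> y Ny; exists 0; rewrite scale0r subr0.
have Lg : L (g + w) by exists 1; rewrite scale1r subrr; exact: sj.1.
have LPw : L (P *: w).
  have := submodule_act P sL Lg; rewrite /act scalerDr Pg add0r.
  exact.
have sI : submodule (L `&` N j.+1).
  split; first by split; [exact: sL.1|exact: sj1.1].
  by move=> a y z [Ly Ny] [Lz Nz]; split; [exact: sL.2|exact: sj1.2].
have LN : L `&` N j.+1 = N j.+1.
  have [| |LE|//] := min _ sI.
  - by move=> y Ny; split; [exact: NL|exact: NN].
  - by move=> y [].
  - case: nNQ; rewrite -LE; split=> //; exact: (submodule_act P sj1).
have NL1 y : N j.+1 y -> L y by rewrite -LN => -[].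
have LgD : L g.
  rewrite -[g](addrK w) -scaleN1r addrC; apply: sL.2 => //; exact: NL1.
move=> x; have [b Nx] := gen x.
suff : L x by [].
rewrite -[x](subrK (b *: g)) addrC; apply: sL.2 => //; exact: NL1.
Qed.

(** 1 in D is not a torsion element. *)
Lemma finite_length_not_free : finite_length M -> ~ lmod_iso M D^o.
Proof.
move=> /finite_length_torsion tors [f [f' ff' f'f]].
have [P P0 Px] := tors (f' 1).
have : f (P *: f' 1) = P *: (1 : D^o) by rewrite linearZ f'f.
rewrite Px linear0 => /esym /eqP; apply/negP.
by rewrite -[P *: _]/(P * 1) mulr1.
Qed.

Lemma cyclic_not_free_torsion (g : M) : (forall x, exists a : D, x = a *: g) ->
  ~ lmod_iso M D^o -> exists2 P : D, P != 0 & P *: g = 0.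
Proof.
move=> gen niso; apply: contrapT => h; apply: niso.
have inj (a b : D) : a *: g = b *: g -> a = b.
  move=> ab; apply/eqP; rewrite -subr_eq0; apply/negPn/negP => ab0; apply: h.
  by exists (a - b) => //; rewrite scalerBl ab subrr.
have [f fE] := choice gen.
have flin : linear (f : M -> D^o).
  move=> a x y; apply: inj; rewrite -fE {1}(fE x) {1}(fE y).
  by rewrite scalerDl -[a *: _ in RHS]/(a * _) -scalerA.
pose flinear : {linear M -> D^o} :=
  HB.pack (f : M -> D^o) (GRing.isLinear.Build D M D^o *:%R f flin).
exists flinear.
exists (fun a : D => a *: g) => [x|a]; first by rewrite -fE.
by apply: inj; rewrite -fE.
Qed.

(** * Holonomic modules have finite length *)

Definition chain l (N : nat -> set M) : Prop :=
  [/\ N 0%N = [set 0], N l = setT, forall k, (k <= l)%N -> submodule (N k)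
    & forall k, (k < l)%N -> N k `<` N k.+1].

Lemma chain_insert l N k L : chain l N -> (k < l)%N -> submodule L ->
  N k `<` L -> L `<` N k.+1 -> exists N', chain l.+1 N'.
Proof.
move=> [N0 Nl sN ltN] kl sL NL LN.
exists (fun j => if (j <= k)%N then N j else if j == k.+1 then L else N j.-1).
split=> [//| |j jl|j jl].
- rewrite leqNgt ltnS (ltnW kl) /=; case: eqP => [|//]; lia.
- case: ifP => jk; first by apply: sN; lia.
  by case: eqP => // _; apply: sN; lia.
- case: (ltngtP j k) => [jk|kj|->].
  + exact/ltN/(ltn_trans jk).
  + rewrite eqSS [j == k]gtn_eqF //=; case: eqP => [->|jk] //.
    by rewrite -[in N j](ltn_predK kj); apply: ltN; lia.
  + by rewrite eqxx.
Qed.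

(** A chain of greatest length cannot be refined, so its steps are simple. *)
Lemma bounded_chains_finite_length b :
  (forall l N, chain l N -> (l <= b)%N) -> finite_length M.
Proof.
move=> bd; pose P l := `[< exists N, chain l N >].
have Pb l : P l -> (l <= b)%N by move=> /asboolP[N]; exact: bd.
have s0 : submodule [set 0 : M] by split=> // a x y -> ->; rewrite scaler0 addr0.
have sT : submodule [set: M] by [].
have P0 : exists l, P l.
  have [M0|nM0] := pselect (forall x : M, x = 0).
    exists 0%N; apply/asboolP; exists (fun=> [set 0]); split=> //.
    by apply/seteqP; split=> // x _; exact: M0.
  exists 1%N; apply/asboolP; exists (fun k => if k is 0%N then [set 0] else setT).
  split=> // [[|k] _ //|[|//] _].
  by split=> // h; apply: nM0 => x; exact: h.
case: (ex_maxnP P0 Pb) => l /asboolP[N cN] lmax.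
exists l, N; have [N0 Nl sN ltN] := cN; split=> // k kl; split; first exact: ltN.
move=> L sL NL LN; apply: contrapT => /not_orP[LN1 LN2].
have [||N' cN'] := chain_insert cN kl sL.
- by split=> // LN'; apply: LN1; apply/seteqP.
- by split=> // NL'; apply: LN2; apply/seteqP.
have /lmax : P l.+1 by apply/asboolP; exists N'.
by rewrite ltnn.
Qed.

Lemma filtration_le (F : int -> set M) n (k : nat) :
  filtration F -> F n `<=` F (n + k%:Z).
Proof.
move=> [_ _ Finc _ _]; elim: k => [|k IH]; first by rewrite addr0.
by move=> x /IH/Finc; rewrite -addrA -PoszD addn1.
Qed.

Lemma filtration_common (F : int -> set M) l (v : nat -> M) : filtration F ->
  exists j : nat, forall k, (k < l)%N -> F j%:Z (v k).
Proof.
move=> fF; have [_ _ _ Fall _] := fF.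
elim: l => [|l [j IH]]; first by exists 0%N.
have [n Fn] := Fall (v l); exists (j + absz n)%N => k; rewrite ltnS leq_eqVlt.
case/orP => [/eqP ->|kl]; last by rewrite PoszD; exact: filtration_le (IH k kl).
have -> : (j + absz n)%N%:Z = n + (absz (j%:Z + (absz n)%:Z - n)%R)%:Z by lia.
exact: filtration_le.
Qed.

(** Choosing v in each N_(i+1) outside N_i, growth gives k vectors of B^(k n1) v
independent modulo N_i; the families for the l steps are independent together.
The index j accounts for the place of the chosen v in the filtration. *)
Lemma chain_families n1 l (N : nat -> set M) (F : int -> set M) :
  growth_rate M n1 -> chain l N -> filtration F ->
  exists j : nat, forall k, exists u : nat -> rM,
    family_in (F (j + k * n1)%N%:Z : set rM) (l * k) u /\
    indep [set 0] (l * k) u.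
Proof.
move=> gr [N0 _ sN ltN] fF.
have /choice[v vP] : forall k, exists v, (k < l)%N -> N k.+1 v /\ ~ N k v.
  move=> k; have [kl|_] := ltnP k l; last by exists 0.
  by have [_ /nonsubset[v [Nv nNv]]] := ltN k kl; exists v.
have [j Fj] := filtration_common l v fF; exists j => k.
suff h : forall i, (i <= l)%N -> exists u : nat -> rM,
    family_in (F (j + k * n1)%N%:Z `&` N i : set rM) (i * k) u /\
    indep [set 0] (i * k) u.
  have [u [Fu iu]] := h l (leqnn l); exists u; split=> // a al.
  by have [] := Fu a al.
elim=> [_|i IH il]; first by exists (fun=> 0); split.
have [u [Fu iu]] := IH (ltnW il); have [Nv nNv] := vP i il.
have [u' [Bu' iu']] := gr _ _ (sN i (ltnW il)) nNv k.
exists (cat_family (i * k) u u'); rewrite mulSnr; split.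
  apply: (@family_cat _ rM) => a ak.
    have [Fa Na] := Fu a ak; split=> //.
    by have [NN _] := ltN i il; exact: NN.
  have [P BP ->] := Bu' a ak; split; last exact: (submodule_act P (sN _ il)).
  have [_ _ _ _ Fmul] := fF; rewrite addnC PoszD.
  by apply: Fmul => //; exact: Fj.
have sNi := submodule_subspace (sN i (ltnW il)).
apply: (indep_cat sNi) => //; first by move=> _ ->; exact: sNi.1.
by move=> a ak; have [] := Fu a ak.
Qed.

(** Chains have length at most e n1. A longer one would give, with t of the order
of k n1, at least e k n1 + k independent vectors in a space of dimension
e t + const, and k is chosen to exceed the constants. *)
Lemma holonomic_finite_length : holonomic M -> finite_length M.
Proof.
case=> [M0|[_ [F [[fF _] [m [P [e [m0 e0 PP [n0 dimF]]]]]]]]].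
  apply: (@bounded_chains_finite_length 0) => l N [N0 Nl sN ltN].
  rewrite leqNgt; apply/negP => l0; have [_] := ltN 0%N l0; apply.
  by move=> x _; rewrite (M0 x); exact: (sN 0%N _).1.
have [n1 n10 gr] := growth cG M.
apply: (@bounded_chains_finite_length (e * n1)) => l N cN.
rewrite leqNgt; apply/negP => ltl.
have [j families] := chain_families gr cN fF.
pose r0 := Ordinal m0; pose b0 := Num.bound `|(P r0)`_0|.
pose k := (b0 + e * (j + n0)).+1; have [u [Fu iu]] := families k.
pose t := (j + n0 + k * n1)%N.
have [d dimd dE] := dimF t r0 (leq_trans (leq_addl _ _) (leq_addr _ _)).
have lkd : (l * k <= d)%N.
  apply: (indep_le_kdim dimd _ iu) => i ilk.
  have tm : (j + k * n1 <= t * m + r0)%N by rewrite /t; nia.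
  by rewrite -(subnKC tm) PoszD; apply: filtration_le => //; exact: Fu.
have [sP P1] := PP r0.
have dle : (d <= b0 + e * t)%N.
  rewrite -(ler_nat rat) dE (horner_coef_wide _ sP) big_ord_recr big_ord1 /=.
  rewrite expr0 mulr1 expr1 P1 divr1 natrD natrM lerD2r.
  apply: le_trans (ler_norm _) _; apply: ltW; exact: archi_boundP.
move: (leq_trans lkd dle); rewrite /t /k; nia.
Qed.

(** * Cyclic torsion modules are holonomic *)

(** An operator of B^n is determined by the coefficients of its components of degrees
-n, ..., n up to order n. The linear form number (w + n)(n + 1) + p reads off
the coefficient of order p in degree w. *)
Lemma bernstein_indep_bounded (n : nat) r (u : nat -> D) :
  family_in (@bernstein K G n%:Z) r u -> indep [set 0] r u ->
  (r <= n.*2.+1 * n.+1)%N.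
Proof.
move=> Bu iu.
pose psi k (P : D) : K := (component P ((k %/ n.+1)%N%:Z - n%:Z))`_(k %% n.+1).
apply: (@indep_le_coords K D [set 0] (@bernstein K G n%:Z) r
  (n.*2.+1 * n.+1) u psi (@bernstein_subspace K G n%:Z) Bu iu).
  by move=> k a P Q; rewrite /psi componentD_linear coefD coefZ.
move=> P BP psi0; apply: diffA_ext => w; rewrite component0.
have gP := @component_admissible K G P w.
have [//|f0] := eqVneq (component P w) 0; exfalso.
have /bernsteinP bP := BP.
have kn := degree_le_weight f0 (bP w).
have lead : (component P w)`_(size (component P w)).-1 != 0.
  by rewrite -lead_coefE lead_coef_eq0.
set k := (size (component P w)).-1 in kn lead *.
have wk : - w <= k%:Z.
  have [w0|w0] := leP 0 w; first by lia.
  have wE : w = - (absz w)%:Z by lia.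
  rewrite {1}wE in gP; have := admissible_size cG gP f0.
  by rewrite /k; set z := size _; lia.
move/eqP: lead; apply.
have kd : (absz (w + n%:Z)%R * n.+1 + k < n.*2.+1 * n.+1)%N.
  have : (absz (w + n%:Z)%R <= n.*2)%N by lia.
  have : (k <= n)%N by lia.
  by nia.
have := psi0 _ kd; rewrite /psi divnMDl // modnMDl divn_small ?modn_small; try lia.
by rewrite addn0 (_ : _ - _ = w); [apply|lia].
Qed.

Section Cyclic.
Variables (g : M) (P0 : D).
Hypotheses (gen : forall x, exists a : D, x = a *: g) (P00 : P0 != 0)
  (P0g : P0 *: g = 0).

Definition orbit_filtration (n : int) : set M :=
  [set x | exists2 P : D, bernstein n P & x = P *: g].
Local Notation F := orbit_filtration.

Lemma orbit_subspace n : subspace (F n : set rM).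
Proof.
have Bs := @bernstein_subspace K G n.
split; first by exists 0; [exact: Bs.1|rewrite scale0r].
move=> a _ _ [P BP ->] [Q BQ ->]; exists (a *: P + Q); first exact: Bs.2.
by rewrite scalerDl -mulr_algl -scalerA.
Qed.

Lemma orbit_le m n : m <= n -> F m `<=` F n.
Proof. by move=> mn _ [P BP ->]; exists P => //; exact: bernstein_le BP. Qed.

Lemma orbit_is_filtration : filtration F.
Proof.
split.
- exact: orbit_subspace.
- move=> n n0; apply/seteqP; split=> [_ [P BP ->]|_ ->].
    by rewrite (bernstein_lt0 cG n0 BP) scale0r.
  exact: (orbit_subspace n).1.
- by move=> n; apply: orbit_le; lia.
- move=> x; have [a ->] := gen x; have [n Bn] := bernstein_exhausts a.
  by exists n; exists a.
- move=> m n _ _ b _ Bb [P BP ->]; exists (b * P); first exact: bernstein_mul.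
  by rewrite scalerA.
Qed.

(** gr M is generated by the class of g in degree 0. *)
Lemma orbit_good_filtration : good_filtration F.
Proof.
split; first exact: orbit_is_filtration.
have B1 := @bernstein1 K G.
pose g0 := fun n : int => if n == 0 then g else 0.
exists 1%N, (fun=> g0); split=> [_|x [finx Fx]].
  split.
    apply: sub_finite_set (finite_set1 (0 : int)) => n; rewrite /mkset /g0.
    by case: (eqVneq n 0) => [->|_] //; rewrite eqxx.
  move=> n; rewrite /g0; case: eqP => [->|_]; last exact: (orbit_subspace n).1.
  by exists 1; rewrite ?scale1r.
have /choice[b bP] : forall n, exists b : D,
    [/\ bernstein n b, x n = b *: g & x n = 0 -> b = 0].
  move=> n; have [x0|x0] := pselect (x n = 0).
    by exists 0; split=> //; [exact: (@bernstein_subspace K G n).1|rewrite scale0r].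
  by have [Q BQ xQ] := Fx n; exists Q.
exists (fun=> b); split=> [_|n].
  split; last by move=> n; have [] := bP n.
  apply: sub_finite_set finx => n; rewrite /mkset.
  by apply: contraNneq => x0; have [_ _ ->] := bP n.
rewrite big_ord1 /gr_act.
rewrite -(@fsbig_widen _ _ _ _ [set 0] setT (fun j => b (n - j) *: g0 j)) //.
  rewrite fsbig_set1 subr0 /g0 eqxx; have [_ <- _] := bP n.
  by rewrite subrr; exact: (orbit_subspace (n - 1)).1.
by move=> j [_ /= j0]; rewrite /g0; case: eqP => // _; rewrite scaler0.
Qed.

Lemma orbit_has_dim (n : int) : exists d, has_dim (F n : set rM) d.
Proof.
have [n0|n0] := ltP n 0.
  exists 0%N, (fun=> 0); split=> // x [P BP ->].
  rewrite (bernstein_lt0 cG n0 BP) scale0r.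
  exact: (span_mod_subspace 0 (fun=> 0) (subspace0 rM)).1.
have nE : n = (absz n)%:Z by lia.
have [|r [u [Fu iu us]]] := @exists_basis_mod _ rM [set 0] (F n)
    ((absz n).*2.+1 * (absz n).+1) (subspace0 _) (orbit_subspace n).
  move=> r u Fu iu.
  have /choice[b bP] : forall k, exists b : D, (k < r)%N ->
      bernstein n b /\ u k = b *: g.
    move=> k; have [kr|_] := ltnP k r; last by exists 0.
    by have [Q BQ uQ] := Fu k kr; exists Q.
  apply: (@bernstein_indep_bounded _ r b).
    by move=> k kr; rewrite -nE; have [] := bP k kr.
  move=> a ab0; apply: iu.
  have -> : lcomb r a u = act (lcomb r a b) (g : rM).
    rewrite /act /lcomb scaler_suml; apply: eq_bigr => k _.
    have [_ ->] := bP k (ltn_ord k).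
    by rewrite -[a k *: b k]mulr_algl -[RHS]scalerA.
  by rewrite ab0 /act scale0r.
by exists r, u.
Qed.

Lemma nonincreasing_stationary (S : nat -> nat) n0 :
  (forall n, (n0 <= n)%N -> (S n.+1 <= S n)%N) ->
  exists2 n1, (n0 <= n1)%N & forall n, (n1 <= n)%N -> S n = S n1.
Proof.
move=> Sdec.
have ex : exists e, `[< exists2 n, (n0 <= n)%N & S n = e >].
  by exists (S n0); apply/asboolP; exists n0.
case: (ex_minnP ex) => e /asboolP[n1 n01 Se] emin.
exists n1 => // n n1n; apply/eqP; rewrite eqn_leq; apply/andP; split.
  rewrite -(subnKC n1n); elim: (n - n1)%N => [|k IH]; first by rewrite addn0.
  by rewrite addnS; apply: leq_trans (Sdec _ _) IH; lia.
rewrite Se; apply: emin; apply/asboolP; exists n => //; lia.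
Qed.

(** The difference S n = dim F_(n+N) - dim F_n is nonincreasing by dim_step and
bernstein_step, hence eventually constant, equal to e. Along each residue class
modulo N the dimension is then linear with the same slope e. *)
Lemma orbit_holonomic : holonomic M.
Proof.
have [M0|nM0] := pselect (forall x : M, x = 0); [by left|right].
have g0 : g <> 0.
  by move=> g0; apply: nM0 => x; have [a ->] := gen x; rewrite g0 scaler0.
split; first by exists g.
exists F; split; first exact: orbit_good_filtration.
have /choice[a aP] := orbit_has_dim.
have amono m n : m <= n -> (a m <= a n)%N.
  move=> mn; have [u [Fu iu _]] := aP m; apply: (indep_le_dim (aP n) _ iu).
  by move=> k ka; apply: (orbit_le mn); exact: Fu.
have [d [BP sP]] := nonzero_symbol cG P00.
have [N [U [N0 BU [n0 stepU]]]] := bernstein_step cG BP sP.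
pose S (n : nat) := (a (n + N)%N%:Z - a n%:Z)%N.
have [n1 n01 Sconst] : exists2 n1, (n0 <= n1)%N & forall n, (n1 <= n)%N -> S n = S n1.
  apply: nonincreasing_stationary => n nn.
  have h : (a (n.+1 + N)%N%:Z + a n%:Z <= a (n + N)%N%:Z + a n.+1%:Z)%N.
    apply: (@dim_step _ rM (F n%:Z) (F n.+1%:Z) (F (n + N)%N%:Z) (F (n.+1 + N)%N%:Z)
      _ _ _ _ (act U)) => //; try exact: orbit_subspace.
    - exact: act_linear.
    - by apply: orbit_le; rewrite lez_nat.
    - move=> _ [Q BQ ->]; exists (U * Q); last by rewrite /act scalerA.
      by rewrite addnC PoszD; exact: bernstein_mul.
    - move=> _ [Q BQ ->]; have [A [B [BA BQ']]] := stepU n.+1 (leqW nn) Q BQ.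
      exists (A *: g); first by exists A.
      exists (Q - (U * A + B * P0)).
        by move: BQ'; rewrite (_ : (n.+1 + N)%N%:Z - 1 = (n + N)%N); [|lia].
      by rewrite scalerBl scalerDl -!scalerA P0g scaler0 addr0.
  rewrite /S; have : (a n%:Z <= a (n + N)%N%:Z)%N by apply: amono; rewrite lez_nat; lia.
  by move: h; lia.
pose e := S n1.
have aS n : (n1 <= n)%N -> a (n + N)%N%:Z = (a n%:Z + e)%N.
  move=> nn; rewrite /e -(Sconst n nn) /S subnKC //.
  by apply: amono; rewrite lez_nat leq_addr.
have aSk n k : (n1 <= n)%N -> a (n + k * N)%N%:Z = (a n%:Z + k * e)%N.
  move=> nn; elim: k => [|k IH]; first by rewrite !mul0n !addn0.
  rewrite mulSn (addnC N) addnA aS; last by lia.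
  by rewrite IH; lia.
have e0 : (0 < e)%N.
  rewrite lt0n; apply/eqP => e0.
  (* If e = 0, the dimensions are bounded along a progression of step N. *)
  have [n2 n20 gr] := growth cG M.
  have s0 : submodule [set 0 : M] by split=> // b x y -> ->; rewrite scaler0 addr0.
  have [u [Bu iu]] := gr _ _ s0 g0 (a n1%:Z).+1.
  have := aSk n1 ((a n1%:Z).+1 * n2)%N (leqnn _); rewrite e0 muln0 addn0 => aE.
  have : ((a n1%:Z).+1 <= a (n1 + (a n1%:Z).+1 * n2 * N)%N%:Z)%N.
    apply: (indep_le_dim (aP _) _ iu) => k ka; have [Q BQ ->] := Bu k ka.
    exists Q => //; apply: bernstein_le BQ; rewrite lez_nat.
    by apply: leq_trans (leq_addl _ _); rewrite leq_pmulr.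
  by rewrite aE ltnn.
exists N, (fun r => e%:R *: 'X + ((a (r + n1 * N)%N%:Z)%:R - (n1 * e)%N%:R)%:P), e.
split=> // [r|].
  split; first by apply: (leq_trans (size_polyD _ _)); rewrite geq_max
    (leq_trans (size_scale_leq _ _)) ?size_polyX // (leq_trans (size_polyC_leq1 _)).
  by rewrite coefD coefZ coefX coefC /= addr0 mulr1.
exists n1 => n r nn; exists (a (n * N + r)%N%:Z).
  exact/kdim_of_has_dim/aP.
rewrite hornerD hornerZ hornerX hornerC.
have -> : (n * N + r = (r + n1 * N) + (n - n1) * N)%N by nia.
rewrite aSk; last by nia.
rewrite natrD !natrM natrB //.
by rewrite mulrBl; ring.
Qed.

End Cyclic.
End Main.

(** * The equivalence *)

Lemma numerical_semigroup_conductor (G : set nat) : numerical_semigroup G ->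
  exists c, forall n, (c <= n)%N -> G n.
Proof.
move=> [_ _ /finite_seqP[s Gs]]; exists (\max_(i <- s) i).+1 => n ltn.
apply: contrapT => nG; have : [set` s] n by rewrite -Gs.
rewrite /= => ns; move: ltn; rewrite ltnNge => /negP; apply.
exact: (leq_bigmax_seq n).
Qed.

Theorem proposition5 (R : realType) (G : set nat) (hG : numerical_semigroup G)
    (M : lmodType (diffA R[i] G)) (hM : fin_gen M) :
  (holonomic M <-> finite_length M) /\
  (finite_length M <-> cyclic M /\ ~ lmod_iso M (diffA R[i] G)^o).
Proof.
have [c cG] := numerical_semigroup_conductor hG.
have hol_fl : holonomic M -> finite_length M.
  exact: (holonomic_finite_length cG).
have fl_cyc : finite_length M -> cyclic M /\ ~ lmod_iso M (diffA R[i] G)^o.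
  move=> fl; split; first exact: (finite_length_cyclic cG fl).
  exact: (finite_length_not_free cG fl).
have cyc_hol : cyclic M /\ ~ lmod_iso M (diffA R[i] G)^o -> holonomic M.
  move=> [[g gen] nfree].
  have [P P0 Pg] := cyclic_not_free_torsion gen nfree.
  exact: (orbit_holonomic cG gen P0 Pg).
by do 2?split; tauto.
Qed.
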